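(* Let $(q_k)_{k\in\mathbb N}$ be a sequence of monic polynomials $q_k\in\mathbb C[z]$ of degrees $n_k>0$ with $n_k\to\infty$, and let $\mu_k$ denote the root distribution of $q_k$. Let $U\subset\mathbb C$ be an open set and $p:U\to\mathbb R$ a nowhere locally constant harmonic function such that the following two conditions are satisfied: 1. $U$ is root-sparse for $(q_k)_k$; 2. for any infinite set $N_1\subset\mathbb N$ there exist an infinite subset $N_2\subset N_1$, a subset $\mathcal E\subset U$ without accumulation points in $U$, and a sequence $(d_k)_k\subset\mathbb R$ such that $$d_k+p_{\mu_k}\to p\quad\text{locally uniformly in }U\setminus\mathcal E\text{ as }k\to\infty\text{ in }N_2.$$ Then for every $m=0,1,2,\ldots$ $$\xi_{k,m}-\xi_k\ \longrightarrow\ m\,\xi_{p'}\quad\text{on }U\text{ as }k\to\infty,$$ where $\xi_{k,m}=\xi_{q_k^{(m)}}$, $\xi_k=\xi_{q_k}$ and $\xi_{p'}$ are the divisors on $U$ of the $m$th derivative $q_k^{(m)}$, of $q_k$, and of the holomorphic function $p'$; that is, $\xi_{k,m}(\phi)-\xi_k(\phi)\to m\,\xi_{p'}(\phi)$ as $k\to\infty$ for every $\phi\in\mathscr C_c(U)$.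
   Context: Write $q_k(z)=\prod_{j=1}^{n_k}(z-z_{k,j})$, roots repeated with multiplicity. The root-counting measure of $q_k$ is $\mu_k^\#=\sum_{j=1}^{n_k}\delta_{z_{k,j}}$, and the root distribution is the probability measure $\mu_k=\frac1{n_k}\mu_k^\#$. The potential of a finite compactly supported Borel measure $\mu$ is $p_\mu(z)=\int\log|z-w|\,d\mu(w)$; thus $p_{\mu_k}=\frac1{n_k}\log|q_k|$ (which is $-\infty$ at zeros of $q_k$). An open set $U\subset\mathbb C$ is root-sparse for $(q_k)_k$ if for every compact $K\subset U$ there is $M=M(K)$ with $\mu_k^\#(K)\le M$ for all sufficiently large $k$. For a harmonic function $h:U\to\mathbb R$, put $h'=2\frac{\partial h}{\partial z}=\left(\frac{\partial}{\partial x}-i\frac{\partial}{\partial y}\right)h$ with $z=x+iy$; $h'$ is holomorphic. ''Nowhere locally constant'' means not constant on any nonempty open subset of $U$. A divisor on an open set $U$ is a map $\xi:U\to\mathbb Z$ such that $\{z:\xi(z)\ne0\}$ has no accumulation points in $U$. $\mathscr C_c(U)$ is the space of continuous functions with compact support in $U$; a divisor acts on $\phi\in\mathscr C_c(U)$ by $\xi(\phi)=\sum_z\xi(z)\phi(z)$ (a finite sum). Convergence $\xi_k\to\xi$ of divisors on $U$ means $\xi_k(\phi)\to\xi(\phi)$ for every $\phi\in\mathscr C_c(U)$. For a holomorphic function $f$ on $U$ that is not identically zero on any component of $U$, its divisor $\xi_f$ is given by $\xi_f(z)=$ the order of the zero of $f$ at $z$ (and $0$ if $f(z)\neq0$). For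 given $m$, $\xi_{k,m}$ is considered only for $k$ large enough that $q_k^{(m)}\not\equiv0$ (all but finitely many $k$). *)

(* Defs.v *)
From HB Require Import structures.
From mathcomp Require Import all_boot all_order all_algebra.
From mathcomp Require Import all_classical all_reals all_analysis.
From mathcomp.real_closed Require Export complex.
Export numFieldNormedType.Exports.

Set Implicit Arguments.
Unset Strict Implicit.
Unset Printing Implicit Defensive.

Import Order.TTheory GRing.Theory Num.Theory.

Local Open Scope classical_set_scope.
Local Open Scope ring_scope.
Local Open Scope complex_scope.

(* Naming the structure R[i] : numClosedFieldType gives it the topology of its
   norm and makes it a normed module over itself, so that [derivable f z 1] for
   f : C R -> C R is complex differentiability. *)
Definition C (R : realType) : numClosedFieldType := R[i].

Definition borelC (R : realType) := g_sigma_algebraType (@open (C R)).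

Definition poly_roots (R : realType) (q : {poly C R}) : seq (C R) :=
  sval (closed_field_poly_normal q).

Definition root_counting_measure (R : realType) (q : {poly C R}) :
    {measure set (borelC R) -> \bar R} :=
  msum (fun j : nat => dirac (nth 0 (poly_roots q) j : borelC R))
       (size (poly_roots q)).

Definition root_distribution (R : realType) (q : {poly C R}) :
    {measure set (borelC R) -> \bar R} :=
  mscale ((((size q).-1)%:R : R)^-1)%:nng (root_counting_measure q).

(* [lne] is the extended logarithm, with [lne 0 = -oo] (whereas [ln 0 = 0]). *)
Definition potential (R : realType) (mu : {measure set (borelC R) -> \bar R})
    (z : C R) : \bar R :=
  (\int[mu]_w lne (complex.Re `|z - (w : C R)|)%:E)%E.

Definition root_sparse (R : realType) (q : nat -> {poly C R})
    (U : set (C R)) : Prop :=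
  forall K : set (C R), compact K -> K `<=` U ->
    exists M : R, \forall k \near \oo,
      (root_counting_measure (q k) K <= M%:E)%E.

Definition no_accumulation_in (R : realType) (U E : set (C R)) : Prop :=
  forall z, U z -> ~ limit_point E z.

(* For extended-real-valued [f k]: a point where [f k] is infinite violates
   the inequality, so the [f k] are required to be finite eventually. *)
Definition unif_cvg_on (R : realType) (F : set_system nat) (A : set (C R))
    (f : nat -> C R -> \bar R) (g : C R -> R) : Prop :=
  forall eps : R, 0 < eps ->
    \forall k \near F, forall z, A z -> (`|f k z - (g z)%:E| < eps%:E)%E.

Definition loc_unif_cvg_on (R : realType) (F : set_system nat) (A : set (C R))
    (f : nat -> C R -> \bar R) (g : C R -> R) : Prop :=
  forall z, A z -> exists2 V, nbhs z V & unif_cvg_on F (A `&` V) f g.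

(* Functions on an open set U are total functions on C R, of which only the
   values on U matter; likewise for divisors on U below. *)
Definition pderivx (R : realType) (h : C R -> R) (z : C R) : R :=
  derive1 (fun t : R => h (t +i* complex.Im z)) (complex.Re z).

Definition pderivy (R : realType) (h : C R -> R) (z : C R) : R :=
  derive1 (fun t : R => h (complex.Re z +i* t)) (complex.Im z).

Definition C1_on (R : realType) (U : set (C R)) (h : C R -> R) : Prop :=
  forall z, U z ->
    [/\ derivable (fun t : R => h (t +i* complex.Im z)) (complex.Re z) 1,
        derivable (fun t : R => h (complex.Re z +i* t)) (complex.Im z) 1,
        {for z, continuous (pderivx h)} & {for z, continuous (pderivy h)}].

Definition harmonic_on (R : realType) (U : set (C R)) (h : C R -> R) : Prop :=
  [/\ C1_on U h, C1_on U (pderivx h), C1_on U (pderivy h) &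
      forall z, U z -> pderivx (pderivx h) z + pderivy (pderivy h) z = 0].

Definition nowhere_locally_constant (R : realType) (U : set (C R))
    (h : C R -> R) : Prop :=
  forall V : set (C R), open V -> V `<=` U -> V !=set0 ->
    ~ exists c : R, forall z, V z -> h z = c.

(* The holomorphic function h' = 2 (d/dz) h attached to a harmonic h. *)
Definition complex_gradient (R : realType) (h : C R -> R) (z : C R) : C R :=
  pderivx h z -i* pderivy h z.

(* n is the order of the zero of f at z: f w = (w - z)^n g w near z, with g
   holomorphic near z and g z != 0. It is unique when it exists. *)
Definition has_zero_order (R : realType) (f : C R -> C R) (z : C R)
    (n : nat) : Prop :=
  exists g : C R -> C R,
    [/\ \forall w \near z, derivable g w 1, g z != 0 &
        \forall w \near z, f w = (w - z) ^+ n * g w].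

(* 0 if f has no order at z, i.e. if f vanishes identically near z or is not
   holomorphic near z. *)
Definition zero_order (R : realType) (f : C R -> C R) (z : C R) : nat :=
  xget 0%N [set n | has_zero_order f z n].

Definition zero_divisor (R : realType) (f : C R -> C R) (z : C R) : int :=
  (zero_order f z)%:Z.

Definition test_function (R : realType) (U : set (C R))
    (phi : C R -> C R) : Prop :=
  let supp := closure [set z | phi z != 0] in
  [/\ continuous phi, compact supp & supp `<=` U].

(* When xi is a divisor on U and phi a test function, only finitely many terms
   are nonzero; the sum would be 0 otherwise. *)
Definition divisor_pairing (R : realType) (U : set (C R)) (xi : C R -> int)
    (phi : C R -> C R) : C R :=
  \sum_(z \in U) phi z *~ xi z.

Definition divisor_cvg (R : realType) (U : set (C R))
    (xik : nat -> C R -> int) (xi : C R -> int) : Prop :=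
  forall phi, test_function U phi ->
    divisor_pairing U (xik k) phi @[k --> \oo] --> divisor_pairing U xi phi.

(* Main.v *)
Require Import Defs.
From mathcomp Require Import all_boot all_order all_algebra.
From mathcomp Require Import all_classical all_reals all_analysis.
From mathcomp Require Import measurable_realfun.
From mathcomp Require Import ring lra.
Import Order.TTheory GRing.Theory Num.Theory.

(** Write n for the degree of q_k. Off the roots, (1/n) log|q_k| is the average
    of log|z - w| over the roots w of q_k, and its complex gradient is the
    average of 1/(z - w), that is q_k'/(n q_k). Logarithms have a quadratic
    Taylor bound away from the roots, so convergence of (1/n) log|q_k| + d_k to
    p forces convergence of q_k'/(n q_k) to p' ([logder_limit]).

    The theorem then follows by differentiating once and iterating. Let f be
    one of the iterated derivatives, of degree n, and suppose that
    Q = f'/(n f) tends to p'. On one hand f''/f' - f'/f = Q'/Q tends to p''/p',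
    so by the argument principle on a small circle about a, f' has as many more
    zeros near a than f as the order of p' at a ([deriv_clusters]). On the other
    hand f''/((n-1) f') = Q + (Q + Q'/Q)/(n-1) tends to p' as well
    ([deriv_avg]), so f' satisfies the same hypothesis.

    Three devices replace contour integrals and compactness of families of
    holomorphic functions.

    - Ultrafilters. If the conclusion fails, it fails on an infinite set of
      indices, and the convergence hypothesis provides an infinite subset N2
      of it. Along an ultrafilter that contains N2 and is finer than the
      filter of neighbourhoods of infinity, every bounded sequence
      converges, and the number of roots in each small disc is eventually
      constant: root sparsity says exactly that these numbers are bounded
      ([clusters_exist]). A limit along this ultrafilter contradicts the choice
      of N2.

    - Cauchy transforms. Near a point a, the boundedly many roots that
      tend to a contribute O(1/n) to Q, so p' is the limit of the averages of
      1/(z - w) over the roots w at distance at least r from a; continuity of p'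
      extends this to a itself and to the exceptional points ([regularity]).
      Expanding 1/(z - w) in powers of z - a with explicit remainder gives
      p' = (z - a)^s g with g holomorphic and g(a) != 0; the expansion must stop,
      since p' does not vanish identically near a ([zero_factor_exists]).

    - Roots of unity. The average of (z - a)/(z - w) over the points
      z = a + rho u with u^n = 1 is 1/(1 - ((w - a)/rho)^n), which tends to 1 or
      0 according to whether w lies inside or outside the circle. This
      is the argument principle for polynomials ([circle_count]).

    Finally, along the ultrafilter the roots of f in the support of a test
    function gather at finitely many points, so sums over roots converge
    ([clusters_sum]). *)

Set Implicit Arguments.
Unset Strict Implicit.
Unset Printing Implicit Defensive.

Local Open Scope classical_set_scope.
Local Open Scope ring_scope.
Local Open Scope complex_scope.

(** * The real modulus and limits of complex sequences *)

Section Modulus.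
Variable R : realType.
Implicit Types z w : C R.

(** Real-valued, whereas `|z| lies in C R, whose order is only partial: an
    inequality between moduli is an inequality in the ordered field R. *)
Definition cmod z : R := complex.Re `|z|.

Lemma normE z : `|z| = (cmod z)%:C. Proof. by []. Qed.

Lemma cmod_ge0 z : 0 <= cmod z.
Proof. by rewrite -ler0c -normE normr_ge0. Qed.

Lemma cmod0 : cmod 0 = 0. Proof. exact: Normc.normc0. Qed.
Lemma cmod1 : cmod 1 = 1. Proof. exact: Normc.normc1. Qed.

Lemma cmod_eq0 z : (cmod z == 0) = (z == 0).
Proof. by rewrite -(normr_eq0 z) normE -(inj_eq (@complexI R)). Qed.

Lemma cmod_gt0 z : (0 < cmod z) = (z != 0).
Proof. by rewrite lt_def cmod_ge0 andbT cmod_eq0. Qed.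

Lemma cmodM z w : cmod (z * w) = cmod z * cmod w.
Proof. exact: Normc.normcM. Qed.

Lemma cmodV z : cmod z^-1 = (cmod z)^-1.
Proof. exact: Normc.normcV. Qed.

Lemma cmodN z : cmod (- z) = cmod z.
Proof. by rewrite /cmod normrN. Qed.

Lemma cmodD z w : cmod (z + w) <= cmod z + cmod w.
Proof. by rewrite -lecR rmorphD -!normE ler_normD. Qed.

Lemma cmodB z w : cmod (z - w) <= cmod z + cmod w.
Proof. by rewrite -(cmodN w) cmodD. Qed.

Lemma cmodC z w : cmod (z - w) = cmod (w - z).
Proof. by rewrite -cmodN opprB. Qed.

Lemma cmod_triangle u z w : cmod (z - w) <= cmod (z - u) + cmod (u - w).
Proof. by rewrite (_ : z - w = (z - u) + (u - w)) ?cmodD //; ring. Qed.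

Lemma cmodX z n : cmod (z ^+ n) = cmod z ^+ n.
Proof. by elim: n => [|n IH]; rewrite ?expr0 ?cmod1 // !exprS cmodM IH. Qed.

Lemma cmod_real (x : R) : cmod (x%:C : C R) = `|x|.
Proof. by rewrite /cmod normc_def /= expr0n addr0 sqrtr_sqr. Qed.

Lemma cmod_nat n : cmod (n%:R : C R) = n%:R.
Proof.
have -> : (n%:R : C R) = (n%:R : R)%:C by rewrite rmorph_nat.
by rewrite cmod_real ger0_norm.
Qed.

Lemma cmod_sqr z : cmod z ^+ 2 = complex.Re z ^+ 2 + complex.Im z ^+ 2.
Proof. by rewrite /cmod normc_def /= sqr_sqrtr ?addr_ge0 ?sqr_ge0. Qed.

Lemma Re_le_cmod z : `|complex.Re z| <= cmod z.
Proof. by rewrite -lecR; exact: normc_ge_Re. Qed.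

Lemma Im_le_cmod z : `|complex.Im z| <= cmod z.
Proof.
rewrite -(@ler_pXn2r _ 2) ?nnegrE ?cmod_ge0 // real_normK ?num_real //.
by rewrite cmod_sqr lerDr sqr_ge0.
Qed.

Lemma cmod_le_ReIm z : cmod z <= `|complex.Re z| + `|complex.Im z|.
Proof.
have h := cmod_sqr z.
rewrite -(@ler_pXn2r _ 2) ?nnegrE ?cmod_ge0 ?addr_ge0 // h.
rewrite -(real_normK (num_real (complex.Re z))).
rewrite -(real_normK (num_real (complex.Im z))).
have := normr_ge0 (complex.Re z); have := normr_ge0 (complex.Im z); nra.
Qed.

Lemma cmod_sum (I : Type) (s : seq I) (P : pred I) (u : I -> C R) :
  cmod (\sum_(i <- s | P i) u i) <= \sum_(i <- s | P i) cmod (u i).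
Proof.
elim/big_rec2: _ => [|i y x _ h]; first by rewrite cmod0.
by apply: le_trans (cmodD _ _) _; rewrite lerD2l.
Qed.

Lemma nbhs_cmodP (a : C R) (A : set (C R)) :
  nbhs a A <-> exists2 r : R, 0 < r & forall z, cmod (z - a) < r -> A z.
Proof.
split.
  move=> /nbhs_ballP [e /= e0 he]; exists (complex.Re e).
    by move: e0; rewrite ltcE => /andP[].
  move=> z hz; apply: he; rewrite -ball_normE /= -normrN opprB normE.
  move: (e0); rewrite !ltcE /= => /andP [/eqP -> _].
  by rewrite eqxx.
move=> [r r0 hr]; apply/nbhs_ballP; exists r%:C; first by rewrite /= ltcR.
move=> z; rewrite -ball_normE /= => hz; apply: hr.
by rewrite -ltcR -normE -normrN opprB.
Qed.

Lemma cvg_cmodP (T : Type) (F : set_system T) {FF : Filter F} (f : T -> C R)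
  (l : C R) :
  f x @[x --> F] --> l <->
  forall e : R, 0 < e -> \forall x \near F, cmod (f x - l) < e.
Proof.
split.
  move=> h e e0; apply: (h [set z | cmod (z - l) < e]).
  by apply/nbhs_cmodP; exists e.
move=> h A /nbhs_cmodP [r r0 hr]; apply: filterS (h r r0) => x /hr.
exact.
Qed.

Lemma cvg_ReIm (T : Type) (F : set_system T) {FF : Filter F} (u v : T -> R)
  (a b : R) : u x @[x --> F] --> a -> v x @[x --> F] --> b ->
  (u x +i* v x : C R) @[x --> F] --> (a +i* b : C R).
Proof.
move=> ua vb; apply/cvg_cmodP => e e0.
have e2 : 0 < e / 2 by lra.
move/cvgrPdist_lt: ua => /(_ _ e2) ha; move/cvgrPdist_lt: vb => /(_ _ e2) hb.
near=> x; apply: le_lt_trans (cmod_le_ReIm _) _.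
rewrite /= -[`|u x - a|]normrN -[`|v x - b|]normrN !opprB.
have : `|a - u x| < e / 2 by near: x.
have : `|b - v x| < e / 2 by near: x.
lra.
Unshelve. all: by end_near. Qed.

Lemma ultra_fmap (T V : Type) (F : set_system T) (FU : UltraFilter F)
  (u : T -> V) : UltraFilter (fmap u F).
Proof.
split; first exact: fmap_proper_filter.
move=> G GF sG; rewrite predeqE => A; split; last exact: sG.
move=> GA; case: (in_ultra_setVsetC (u @^-1` A) FU) => // nA.
have : G (~` A) by apply: sG.
by move=> /(filterI GA); rewrite setICr => /filter_not_empty.
Qed.

Lemma ultra_bounded_cvgR (T : Type) (F : set_system T) {FU : UltraFilter F}
    (u : T -> R) (M : R) :
  (\forall x \near F, `|u x| <= M) -> exists l : R, u x @[x --> F] --> l.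
Proof.
move=> h.
have cpt := @segment_compact R (- M) M.
rewrite compact_ultra in cpt.
have UI := ultra_fmap FU u.
have [|l [_ hl]] := cpt _ UI; last by exists l.
by apply: filterS h => x; rewrite /= in_itv /= ler_norml.
Qed.

 
Lemma ultra_bounded_cvg (T : Type) (F : set_system T) {FU : UltraFilter F}
    (u : T -> C R) (M : R) :
  (\forall x \near F, cmod (u x) <= M) -> exists l : C R, u x @[x --> F] --> l.
Proof.
move=> h.
have [|a ha] := @ultra_bounded_cvgR T F FU (fun x => complex.Re (u x)) M.
  by apply: filterS h => x; apply: le_trans (Re_le_cmod _).
have [|b hb] := @ultra_bounded_cvgR T F FU (fun x => complex.Im (u x)) M.
  by apply: filterS h => x; apply: le_trans (Im_le_cmod _).
exists (a +i* b); have huE : u = (fun t => complex.Re (u t) +i* complex.Im (u t)).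
  by apply: funext => t; case: (u t).
rewrite huE; exact: cvg_ReIm ha hb.
Qed.

Lemma cvg_cmod_le (T : Type) (F : set_system T) {FF : ProperFilter F}
    (u : T -> C R) (l c : C R) (M : R) :
  u x @[x --> F] --> l -> (\forall x \near F, cmod (u x - c) <= M) ->
  cmod (l - c) <= M.
Proof.
move=> /cvg_cmodP ul hM; rewrite leNgt; apply/negP => hlt.
have e0 : 0 < cmod (l - c) - M by lra.
have [x [h1 h2]] := filter_ex (filterI (ul _ e0) hM).
have := cmod_triangle (u x) l c; rewrite (cmodC l (u x)); lra.
Qed.

Lemma cvg_uniq (T : Type) (F : set_system T) {FF : ProperFilter F}
    (u : T -> C R) (l l' : C R) :
  u x @[x --> F] --> l -> u x @[x --> F] --> l' -> l = l'.
Proof. by move=> h h'; apply: cvg_unique h h'; exact: norm_hausdorff. Qed.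

Lemma compact_disc (a : C R) (r : R) : compact [set z : C R | cmod (z - a) <= r].
Proof.
rewrite compact_ultra => F FU Fr.
have [|l hl] := @ultra_bounded_cvg _ F FU id (r + cmod a).
  apply: filterS Fr => z /=; rewrite {2}(_ : z = (z - a) + a); last by ring.
  by move=> h; apply: le_trans (cmodD _ _) _; rewrite lerD2r.
exists l; split; last exact: hl.
exact: cvg_cmod_le hl Fr.
Qed.

Lemma ultra_cvg_compact (F : set_system nat) {FU : UltraFilter F}
   (K : set (C R)) (u : nat -> C R) :
  compact K -> (\forall k \near F, K (u k)) ->
  exists2 l, K l & u k @[k --> F] --> l.
Proof.
move=> cK hK; rewrite compact_ultra in cK.
have UI := ultra_fmap FU u.
by have [l [Kl hl]] := cK _ UI hK; exists l.
Qed.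

End Modulus.

(** * Logarithmic derivatives and the discrete argument principle *)

Section Roots.
Variable R : realType.
Implicit Types (f g : {poly C R}) (z w a : C R) (s : seq (C R)).

Lemma poly_rootsE f :
  f = lead_coef f *: \prod_(z <- poly_roots f) ('X - z%:P).
Proof. by rewrite /poly_roots; case: closed_field_poly_normal. Qed.

Lemma size_poly_roots f : f != 0 -> size (poly_roots f) = (size f).-1.
Proof.
move=> f0; rewrite [in RHS](poly_rootsE f) size_scale ?lead_coef_eq0 //.
by rewrite size_prod_XsubC.
Qed.

Lemma root_poly_roots f z : f != 0 -> (f.[z] == 0) = (z \in poly_roots f).
Proof.
move=> f0; rewrite -root_prod_XsubC [in LHS](poly_rootsE f) hornerZ mulf_eq0.
by rewrite lead_coef_eq0 (negPf f0).
Qed.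

Lemma deriv_one : (1 : {poly C R})^`() = 0.
Proof. exact: derivC. Qed.

(** The power sums of 1/(z - w), which express the logarithmic derivatives of
    the polynomial with root sequence s. *)
Definition invsum (j : nat) s z : C R := \sum_(w <- s) (z - w) ^- j.

Lemma logder_prod s z (f := \prod_(w <- s) ('X - w%:P)) :
  z \notin s ->
  f^`().[z] = f.[z] * invsum 1 s z /\
  f^`()^`().[z] = f.[z] * (invsum 1 s z ^+ 2 - invsum 2 s z).
Proof.
rewrite /f /invsum {f}; elim: s => [|w s IH].
  by rewrite !big_nil deriv_one linear0 horner0 expr0n /= subr0 mulr0.
rewrite inE negb_or => /andP[zw /IH [h1 h2]].
have zw0 : z - w != 0 by rewrite subr_eq0.
rewrite !big_cons !derivM !derivXsubC !derivD !derivM !derivXsubC deriv_one.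
rewrite !mul1r !mul0r !add0r !(hornerXsubC, hornerD, hornerM) h1 h2.
split; field; exact: zw0.
Qed.

Lemma logder1 f z : f.[z] != 0 ->
  f^`().[z] = f.[z] * invsum 1 (poly_roots f) z.
Proof.
move=> fz; have f0 : f != 0 by apply: contraNneq fz => ->; rewrite horner0.
have zs : z \notin poly_roots f by rewrite -root_poly_roots.
have [h _] := logder_prod zs.
by rewrite {1 2}(poly_rootsE f) derivZ !hornerZ h mulrA.
Qed.

Lemma logder2 f z : f.[z] != 0 ->
  f^`()^`().[z] =
  f.[z] * (invsum 1 (poly_roots f) z ^+ 2 - invsum 2 (poly_roots f) z).
Proof.
move=> fz; have f0 : f != 0 by apply: contraNneq fz => ->; rewrite horner0.
have zs : z \notin poly_roots f by rewrite -root_poly_roots.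
have [_ h] := logder_prod zs.
by rewrite {1 2}(poly_rootsE f) !derivZ !hornerZ h mulrA.
Qed.

(** With S1, S2 the first two power sums for f, f'/f = S1 and
    f''/f = S1^2 - S2, hence f''/f' - f'/f = - S2/S1. The left-hand sum is f''/f',
    because f' is a polynomial with its own roots. *)
Lemma logder_deriv f z : f.[z] != 0 -> f^`().[z] != 0 ->
  invsum 1 (poly_roots f^`()) z =
  invsum 1 (poly_roots f) z
    - invsum 2 (poly_roots f) z / invsum 1 (poly_roots f) z.
Proof.
move=> fz f'z; have h1 := logder1 fz; have h2 := logder2 fz.
have h3 := logder1 f'z.
have s0 : invsum 1 (poly_roots f) z != 0.
  by apply: contraNneq f'z => e; rewrite h1 e mulr0.
apply: (mulfI f'z); rewrite -h3 h2 h1.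
by field.
Qed.

Definition root_count f a (r : R) : nat :=
  count (fun w => cmod (w - a) < r) (poly_roots f).

Lemma cvg_expC0 (x : C R) : cmod x < 1 -> x ^+ n @[n --> \oo] --> (0 : C R).
Proof.
move=> x1; apply/cvg_cmodP => e e0.
have h : `|cmod x| < 1 by rewrite ger0_norm ?cmod_ge0.
have /cvgrPdist_lt /(_ _ e0) := @cvg_expr R (cmod x) h.
apply: filterS => n; rewrite sub0r normrN ger0_norm ?exprn_ge0 ?cmod_ge0 //.
by rewrite subr0 cmodX.
Qed.

(** Evaluate the logarithmic derivative of X^N - 1 at x, using
    u/(u - x) = 1 - x/(x - u). *)
Lemma unity_sum (n : nat) (x : C R) : x ^+ n.+1 != 1 ->
  \sum_(w <- poly_roots ('X^(n.+1) - 1 : {poly C R})) w / (w - x) =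
  n.+1%:R / (1 - x ^+ n.+1).
Proof.
move=> xn; set f : {poly C R} := 'X^(n.+1) - 1.
have fE y : f.[y] = y ^+ n.+1 - 1 by rewrite /f !hornerE.
have fx : f.[x] != 0 by rewrite fE subr_eq0.
have f0 : f != 0 by apply: contraNneq fx => ->; rewrite horner0.
have sz : size (poly_roots f) = n.+1.
  by rewrite size_poly_roots // /f -polyC1 size_XnsubC.
have h := logder1 fx.
rewrite {1}/f derivB derivXn deriv_one subr0 hornerMn hornerXn /= in h.
have h' : invsum 1 (poly_roots f) x = n.+1%:R * x ^+ n / (x ^+ n.+1 - 1).
  apply: (mulfI fx); rewrite -h fE -mulr_natl.
  by rewrite [RHS]mulrCA divff ?subr_eq0 // mulr1.
rewrite (eq_big_seq (fun w => 1 - x * (x - w) ^- 1)); last first.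
  move=> w ws.
  have xw : x - w != 0.
    by rewrite subr_eq0; apply: contraNneq fx => ->; rewrite root_poly_roots.
  have wx : w - x != 0 by rewrite -opprB oppr_eq0.
  by field; rewrite xw wx.
rewrite sumrB -mulr_sumr big_const_seq count_predT sz.
rewrite -[\sum_(i <- _) _]/(invsum 1 (poly_roots f) x) h'.
have -> : iter n.+1 (+%R 1) 0 = n.+1%:R :> C R by rewrite -Monoid.iteropE.
have x1 : 1 - x ^+ n.+1 != 0 by rewrite subr_eq0 eq_sym.
have x2 : x ^+ n.+1 - 1 != 0 by rewrite subr_eq0.
by move: x1 x2; rewrite exprS => x1 x2; field; rewrite x1 x2.
Qed.

Lemma unity_root_cmod n (w : C R) :
  w \in poly_roots ('X^(n.+1) - 1 : {poly C R}) -> cmod w = 1.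
Proof.
rewrite -root_poly_roots; last first.
  by rewrite -size_poly_eq0 -polyC1 size_XnsubC.
rewrite !hornerE subr_eq0 => /eqP h.
have : cmod w ^+ n.+1 = 1 by rewrite -cmodX h cmod1.
by move/eqP; rewrite pexprn_eq1 ?cmod_ge0 // => /eqP.
Qed.

(** Applied to x = (w - a)/rho, this is the limit of the discrete contour
    integral of 1/(z - w) over the circle of centre a and radius rho. *)
Lemma cvg_geom_indicator (x : C R) : cmod x != 1 ->
  (1 - x ^+ n.+1)^-1 @[n --> \oo] --> ((cmod x < 1)%R%:R : C R).
Proof.
move=> x1; case: ltP => hx /=.
  have -> : (1%:R : C R) = (1 - 0)^-1 by rewrite subr0 invr1.
  apply: cvgV; first by rewrite subr0 oner_neq0.
  apply: cvgB; first exact: cvg_cst.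
  by have := cvg_expC0 hx; rewrite -(cvg_shiftS (fun n => x ^+ n)).
have {}hx : 1 < cmod x by rewrite lt_neqAle eq_sym x1.
have x0 : x != 0 by rewrite -cmod_gt0; lra.
have hV : cmod x^-1 < 1 by rewrite cmodV invf_lt1 //; lra.
have E n : (1 - x ^+ n.+1)^-1 = x^-1 ^+ n.+1 * (x^-1 ^+ n.+1 - 1)^-1.
  have n0 : 1 - x ^+ n.+1 != 0.
    rewrite subr_eq0; apply: contraTneq hx => h.
    have : cmod x ^+ n.+1 = 1 by rewrite -cmodX -h cmod1.
    by move/eqP; rewrite pexprn_eq1 ?cmod_ge0 // => /eqP ->; rewrite ltxx.
  rewrite exprVn; have y0 : x ^+ n.+1 != 0 by rewrite expf_neq0.
  by move: (x ^+ _) y0 n0 => y y0 n0; field; rewrite y0 mulN1r n0.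
have -> : (fun n => (1 - x ^+ n.+1)^-1) =
          (fun n => x^-1 ^+ n.+1 * (x^-1 ^+ n.+1 - 1)^-1).
  by apply: funext => n; exact: E.
have h0 : x^-1 ^+ n.+1 @[n --> \oo] --> (0 : C R).
  by have := cvg_expC0 hV; rewrite -(cvg_shiftS (fun n => x^-1 ^+ n)).
rewrite -[X in _ --> X](mul0r ((0 - 1)^-1)).
apply: (cvgM h0); apply: cvgV; first by rewrite sub0r oppr_eq0 oner_neq0.
exact: (cvgB h0 (cvg_cst _)).
Qed.

Lemma circle_average (rho : R) a (rs : seq (C R)) (n : nat) :
  0 < rho -> (forall w, w \in rs -> cmod (w - a) != rho) ->
  n.+1%:R^-1 * \sum_(u <- poly_roots ('X^(n.+1) - 1 : {poly C R}))
     (rho%:C * u) * invsum 1 rs (a + rho%:C * u) =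
  \sum_(w <- rs) (1 - ((w - a) / rho%:C) ^+ n.+1)^-1.
Proof.
move=> rho0 hrs.
have rc0 : (rho%:C : C R) != 0 by rewrite -cmod_gt0 cmod_real gtr0_norm.
under eq_bigr do rewrite mulr_sumr.
rewrite exchange_big /= mulr_sumr; apply: eq_big_seq => w /hrs hw.
set x : C R := (w - a) / rho%:C.
have x1 : cmod x != 1.
  rewrite /x cmodM cmodV cmod_real gtr0_norm //; apply: contraNneq hw => h.
  by rewrite (divr1_eq h).
have xn : x ^+ n.+1 != 1.
  apply: contraNneq x1 => h; have := cmodX x n.+1; rewrite h cmod1 => /esym/eqP.
  by rewrite pexprn_eq1 ?cmod_ge0.
rewrite (eq_big_seq (fun u => u / (u - x))).
  by rewrite unity_sum // mulrA mulVf ?mul1r // pnatr_eq0.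
move=> u /unity_root_cmod hu.
have ux : u - x != 0.
  by rewrite subr_eq0; apply: contraNneq x1 => <-; rewrite hu.
have -> : a + rho%:C * u - w = rho%:C * (u - x) by rewrite /x; field.
by field; rewrite rc0 ux.
Qed.

Lemma nat_cmod_inj (m n : nat) : cmod (m%:R - n%:R : C R) < 1 -> m = n.
Proof.
wlog le_nm : m n / (n <= m)%N => [hw|].
  case: (leqP n m) => [|/ltnW] le; first exact: hw.
  by rewrite cmodC => h; apply/esym/hw.
rewrite -(natrB _ le_nm) cmod_nat -[1]/(1%N%:R) ltr_nat ltnS leqn0 subn_eq0 => le_mn.
by apply/eqP; rewrite eqn_leq le_nm le_mn.
Qed.

(** The discrete argument principle: averaging over roots of unity keeps the
    quantity that is close to s on the circle within 1/2 of s, while its average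
    tends to the difference of the two counts, an integer. *)
Lemma circle_count (rho : R) a (rs ts : seq (C R)) (s : nat) :
  0 < rho ->
  (forall w, w \in rs -> cmod (w - a) != rho) ->
  (forall w, w \in ts -> cmod (w - a) != rho) ->
  (forall z, cmod (z - a) = rho ->
    cmod ((z - a) * (invsum 1 rs z - invsum 1 ts z) - s%:R) <= 1 / 2) ->
  count (fun w => cmod (w - a) < rho) rs =
  (count (fun w => cmod (w - a) < rho)%R ts + s)%N.
Proof.
move=> rho0 hrs hts hz.
have rc0 : (rho%:C : C R) != 0 by rewrite -cmod_gt0 cmod_real gtr0_norm.
pose av (rs : seq (C R)) (n : nat) : C R :=
  \sum_(w <- rs) (1 - ((w - a) / rho%:C) ^+ n.+1)^-1.
have avl (us : seq (C R)) : (forall w, w \in us -> cmod (w - a) != rho) ->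
    av us n @[n --> \oo] --> ((count (fun w => cmod (w - a) < rho) us)%:R : C R).
  rewrite /av; elim: us => [|w us IH] hus.
    have -> : (fun n => \sum_(w <- [::]) (1 - ((w - a) / rho%:C) ^+ n.+1)^-1) =
              (fun=> 0 : C R) by apply: funext => n; rewrite big_nil.
    exact: cvg_cst.
  have -> : (fun n => \sum_(v <- w :: us) (1 - ((v - a) / rho%:C) ^+ n.+1)^-1) =
     (fun n => (1 - ((w - a) / rho%:C) ^+ n.+1)^-1 +
       \sum_(v <- us) (1 - ((v - a) / rho%:C) ^+ n.+1)^-1).
    by apply: funext => n; rewrite big_cons.
  rewrite /=.
  have h1 : forall w, w \in us -> cmod (w - a) != rho.
    by move=> v vs; apply: hus; rewrite inE vs orbT.
  have hE : cmod ((w - a) / rho%:C) = cmod (w - a) / rho.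
    by rewrite cmodM cmodV cmod_real gtr0_norm.
  have -> : (cmod (w - a) < rho) = (cmod ((w - a) / rho%:C) < 1).
    by rewrite hE ltr_pdivrMr // mul1r.
  rewrite natrD; apply: (cvgD _ (IH h1)); apply: cvg_geom_indicator; rewrite hE.
  apply: contraNneq (hus w (mem_head _ _)) => h.
  by rewrite (divr1_eq h).
have hb n : cmod (av rs n - av ts n - s%:R) <= 1 / 2.
  rewrite /av -!circle_average // -mulrBr -sumrB.
  set U := poly_roots _.
  have szU : size U = n.+1.
    rewrite size_poly_roots /U -?polyC1 ?size_XnsubC //.
    by rewrite -size_poly_eq0 size_XnsubC.
  have n0 : (n.+1%:R : C R) != 0 by rewrite pnatr_eq0.
  have -> : (s%:R : C R) = n.+1%:R^-1 * \sum_(u <- U) s%:R.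
    by rewrite big_const_seq count_predT szU iter_addr_0 -(mulr_natl (s%:R : C R) n.+1) mulrA mulVf // mul1r.
  rewrite -mulrBr -sumrB cmodM cmodV cmod_nat.
  rewrite mulrC ler_pdivrMr ?ltr0n //.
  apply: le_trans (cmod_sum _ _ _) _.
  have -> : 1 / 2 * n.+1%:R = \sum_(u <- U) (1 / 2) :> R.
    by rewrite big_const_seq count_predT szU iter_addr_0 mulr_natr.
  rewrite big_seq [leRHS]big_seq; apply: ler_sum => u /unity_root_cmod hu.
  have := hz (a + rho%:C * u); rewrite addrAC subrr add0r mulrBr; apply.
  by rewrite cmodM hu cmod_real mulr1 gtr0_norm.
set A := count _ rs; set B := count _ ts.
have h : cmod (A%:R - B%:R - s%:R : C R) < 1.
  have {}hb : \forall n \near \oo, cmod (av rs n - av ts n - s%:R) <= 1 / 2.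
    exact: nearW.
  apply: (@le_lt_trans _ _ (1 / 2)); last by rewrite ltr_pdivrMr // mul1r ltr1n.
  by apply: cvg_cmod_le hb; apply: (cvgB (avl _ hrs) (avl _ hts)).
by apply: nat_cmod_inj; rewrite natrD opprD addrA.
Qed.

End Roots.

(** * Derivatives with a quadratic remainder *)

Section QuadraticDerivative.
Variable R : realType.
Implicit Types (g h : C R -> C R) (a z D : C R).

(** Complex differentiability with a quadratic error term. All the functions
    at hand satisfy it, it passes to pointwise limits when K and r are uniform,
    and it determines D. *)
Definition qderiv g z D := exists2 K : R, 0 <= K &
  exists2 r : R, 0 < r & forall t : C R, cmod t < r ->
    cmod (g (z + t) - g z - t * D) <= K * cmod t ^+ 2.

Lemma cmod_eps (x : C R) : (forall e : R, 0 < e -> cmod x <= e) -> x = 0.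
Proof.
move=> h; apply/eqP; rewrite -cmod_eq0; apply/eqP/le_anti.
rewrite cmod_ge0 andbT; apply/ler_addgt0Pr => e e0.
by rewrite add0r h.
Qed.

Lemma cmod_realp (x : R) : 0 <= x -> cmod (x%:C : C R) = x.
Proof. by move=> x0; rewrite cmod_real ger0_norm. Qed.

Lemma qderiv_uniq g z D D' : qderiv g z D -> qderiv g z D' -> D = D'.
Proof.
move=> [K K0 [r r0 h]] [K' K'0 [r' r'0 h']]; apply/eqP; rewrite -subr_eq0.
apply/eqP/cmod_eps => e e0.
(* A real increment t for which both expansions hold and (K + K') t <= e. *)
pose t := Num.min (Num.min r r' / 2) (e / (K + K' + 1)).
have t0 : 0 < t by rewrite !lt_min !divr_gt0 ?lt_min ?r0 ?r'0 //; lra.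
have tr : t <= Num.min r r' / 2 by rewrite ge_min lexx.
have te : t * (K + K' + 1) <= e.
  by rewrite -ler_pdivlMr ?ge_min ?lexx ?orbT //; lra.
have tr1 : t < r.
  have := ge_min (Num.min r r') r r'; move: tr; rewrite /=.
  have : Num.min r r' <= r by rewrite ge_min lexx.
  lra.
have tr2 : t < r'.
  have : Num.min r r' <= r' by rewrite ge_min lexx orbT.
  lra.
have ct : cmod (t%:C : C R) = t by rewrite cmod_realp // ltW.
have := h t%:C; have := h' t%:C; rewrite ct => /(_ tr2) h2 /(_ tr1) h1.
have : cmod (t%:C * (D - D')) <= K * t ^+ 2 + K' * t ^+ 2.
  have -> : t%:C * (D - D') = (g (z + t%:C) - g z - t%:C * D')
      - (g (z + t%:C) - g z - t%:C * D) by ring.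
  by apply: le_trans (cmodB _ _) _; lra.
rewrite cmodM ct -mulrDl expr2 mulrCA ler_pM2l // => h3.
by apply: le_trans h3 _; nra.
Qed.

Lemma eq_qderiv g h z D (r : R) : 0 < r ->
  (forall w, cmod (w - z) < r -> g w = h w) -> qderiv g z D -> qderiv h z D.
Proof.
move=> r0 E [K K0 [r' r'0 H]]; exists K => //; exists (Num.min r r').
  by rewrite lt_min r0.
move=> t; rewrite lt_min => /andP[t1 t2].
rewrite -!E ?subrr ?cmod0 //; last by rewrite addrAC subrr add0r.
exact: H.
Qed.

Lemma qderiv_XsubM g z D a : qderiv g z D ->
  qderiv (fun w => (w - a) * g w) z (g z + (z - a) * D).
Proof.
move=> [K K0 [r r0 H]].
exists (cmod (z - a) * K + (cmod D + K * r)).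
  by rewrite !addr_ge0 ?mulr_ge0 ?cmod_ge0 // ltW.
exists r => // t tr; have t0 := cmod_ge0 t.
have -> : (z + t - a) * g (z + t) - (z - a) * g z - t * (g z + (z - a) * D) =
  (z - a) * (g (z + t) - g z - t * D)
  + t * (t * D + (g (z + t) - g z - t * D)) by ring.
have h1 := H _ tr.
rewrite [leRHS]mulrDl; apply: le_trans (cmodD _ _) _; apply: lerD.
  by rewrite cmodM -mulrA ler_wpM2l ?cmod_ge0.
rewrite cmodM expr2 mulrCA ler_wpM2l // [leRHS]mulrDl.
apply: le_trans (cmodD _ _) _; apply: lerD; first by rewrite cmodM mulrC.
apply: le_trans h1 _; rewrite expr2 mulrA.
by rewrite ler_wpM2r // ler_wpM2l // ltW.
Qed.

(** The second conjunct is the logarithmic derivative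
    (z - a) G'/G = s + (z - a) g'/g of G = (z - a)^s g, without denominators. *)
Lemma qderiv_Xsub_pow g z D a s : qderiv g z D ->
  exists2 D', qderiv (fun w => (w - a) ^+ s * g w) z D' &
    (z - a) * D' = (z - a) ^+ s * (s%:R * g z + (z - a) * D).
Proof.
move=> hg; elim: s => [|s [D' h1 h2]].
  exists D; last by rewrite expr0 mul0r add0r mul1r.
  by apply: (eq_qderiv ltr01 _ hg) => w _; rewrite expr0 mul1r.
exists ((z - a) ^+ s * g z + (z - a) * D').
  apply: (eq_qderiv ltr01 _ (qderiv_XsubM a h1)) => w _.
  by rewrite exprS mulrA.
by rewrite mulrDr h2 exprS -natr1; ring.
Qed.

Lemma qderiv_derivable g z D : qderiv g z D -> derivable g z 1.
Proof.
move=> [K K0 [r r0 H]]; apply/cvg_ex; exists D; apply/cvg_cmodP => e e0.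
have hd : 0 < Num.min r (e / (K + 1)).
  by rewrite lt_min r0 divr_gt0 //; lra.
rewrite /dnbhs near_withinE; apply/nbhs_cmodP.
exists (Num.min r (e / (K + 1))) => // t; rewrite subr0 lt_min => /andP[tr te] t0 /=.
have ct : 0 < cmod t by rewrite cmod_gt0.
have -> : t^-1 *: (g (t *: 1 + z) - g z) - D = t^-1 * (g (z + t) - g z - t * D).
  have -> : t *: 1 + z = z + t by rewrite addrC -[t *: 1]/(t * 1) mulr1.
  rewrite -[t^-1 *: _]/(t^-1 * _); field; exact: t0.
rewrite cmodM cmodV mulrC ltr_pdivrMr //.
apply: le_lt_trans (H _ tr) _; rewrite expr2 mulrA ltr_pM2r //.
move: te; rewrite ltr_pdivlMr ?ltr_wpDl //; nra.
Qed.

Lemma qderiv_lip g z D : qderiv g z D -> exists2 K : R, 0 <= K & exists2 r : R, 0 < r &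
  forall t : C R, cmod t < r -> cmod (g (z + t) - g z) <= K * cmod t.
Proof.
move=> [K K0 [r r0 H]]; exists (cmod D + K * r).
  by rewrite addr_ge0 ?cmod_ge0 ?mulr_ge0 // ltW.
exists r => // t tr; have t0 := cmod_ge0 t.
have -> : g (z + t) - g z = t * D + (g (z + t) - g z - t * D) by ring.
apply: le_trans (cmodD _ _) _; rewrite [leRHS]mulrDl cmodM [cmod t * _]mulrC lerD2l.
apply: le_trans (H _ tr) _; by rewrite expr2 mulrA ler_wpM2r // ler_wpM2l // ltW.
Qed.

End QuadraticDerivative.

(** * Averages over roots and their limits along an ultrafilter *)

Section Averages.
Variable R : realType.
Variables (F : set_system nat) (FU : UltraFilter F).
Implicit Types (f : nat -> {poly C R}) (A : pred (C R)) (u v : C R -> C R).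
Implicit Types (a b z w : C R).

(** The roots are weighted by the inverse of the full degree, even when A
    excludes some of them; on a region A where u is bounded the averages are
    then bounded uniformly in k. *)
Definition avg f A u (k : nat) : C R :=
  ((size (f k)).-1%:R)^-1 * \sum_(w <- poly_roots (f k) | A w) u w.

(** A total function; [limavg_cvg] says that the limit exists as soon as u is
    bounded on A. It is a linear functional of norm at most 1. *)
Definition limavg f A u : C R := xget 0 [set l | avg f A u k @[k --> F] --> l].

Lemma avg_le f A u k (M : R) : 0 <= M ->
  (forall w, A w -> cmod (u w) <= M) -> cmod (avg f A u k) <= M.
Proof.
move=> M0 hu; rewrite /avg; have [->|n0] := eqVneq (size (f k)).-1 0%N.
  by rewrite invr0 mul0r cmod0.
have fk0 : f k != 0 by apply: contraNneq n0 => ->; rewrite size_poly0.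
rewrite cmodM cmodV cmod_nat mulrC ler_pdivrMr ?ltr0n ?lt0n //.
apply: le_trans (cmod_sum _ _ _) _.
apply: (@le_trans _ _ (\sum_(w <- poly_roots (f k) | A w) M)).
  by apply: ler_sum => w; exact: hu.
rewrite big_const_seq iter_addr_0 -(mulr_natr M) ler_wpM2l // ler_nat.
by rewrite -size_poly_roots // count_size.
Qed.

Lemma limavg_cvg f A u (M : R) : (forall w, A w -> cmod (u w) <= M) ->
  avg f A u k @[k --> F] --> limavg f A u.
Proof.
move=> hu; have [|l hl] := @ultra_bounded_cvg R _ F FU (avg f A u) (`|M|).
  apply: nearW => k; apply: avg_le => // w /hu h.
  by apply: le_trans h (ler_norm _).
rewrite /limavg; case: xgetP => [//|h].
by case: (h l).
Qed.

Lemma limavg_eq f A u l : avg f A u k @[k --> F] --> l -> limavg f A u = l.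
Proof.
move=> hl; rewrite /limavg; case: xgetP => [x _ hx|h]; first exact: cvg_uniq hx hl.
by case: (h l).
Qed.

Lemma limavg_le f A u (M : R) : 0 <= M -> (forall w, A w -> cmod (u w) <= M) ->
  cmod (limavg f A u) <= M.
Proof.
move=> M0 hu; rewrite -[limavg f A u]subr0.
apply: cvg_cmod_le (limavg_cvg (f := f) hu) _.
by apply: nearW => k; rewrite subr0; exact: avg_le.
Qed.

Lemma avg_ext f A u v k : (forall w, A w -> u w = v w) -> avg f A u k = avg f A v k.
Proof. by move=> h; rewrite /avg; congr (_ * _); apply: eq_bigr. Qed.

Lemma limavg_ext f A u v : (forall w, A w -> u w = v w) ->
  limavg f A u = limavg f A v.
Proof.
by move=> h; rewrite /limavg; have -> // : avg f A u = avg f A v;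
  apply: funext => k; exact: avg_ext.
Qed.

Lemma avgD f A u v c k :
  avg f A (fun w => u w + c * v w) k = avg f A u k + c * avg f A v k.
Proof. by rewrite /avg big_split /= -mulr_sumr; ring. Qed.

Lemma limavgD f A u v c (M N : R) :
  (forall w, A w -> cmod (u w) <= M) -> (forall w, A w -> cmod (v w) <= N) ->
  limavg f A (fun w => u w + c * v w) = limavg f A u + c * limavg f A v.
Proof.
move=> hu hv; apply: limavg_eq.
have -> : avg f A (fun w => u w + c * v w) = fun k => avg f A u k + c * avg f A v k.
  by apply: funext => k; exact: avgD.
exact: (cvgD (limavg_cvg hu) (cvgM (cvg_cst c) (limavg_cvg hv))).
Qed.

Definition far a (r : R) : pred (C R) := fun w => r <= cmod (w - a).

Lemma far_dist a (r : R) z w : far a r w -> r - cmod (z - a) <= cmod (z - w).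
Proof.
rewrite /far => h; have := cmod_triangle z w a; rewrite (cmodC w z); lra.
Qed.

Lemma cmod_inv_le (x : C R) (d : R) : 0 < d -> d <= cmod x -> cmod x^-1 <= d^-1.
Proof. by move=> d0 dx; rewrite cmodV lef_pV2 ?posrE // (lt_le_trans d0). Qed.

(** Differentiation under the limit of averages: the remainder of 1/(x - w) at
    z, to second order, is bounded uniformly in w. *)
Lemma cauchy_qderiv f a (r : R) v (M : R) z : 0 < r ->
  0 <= M -> (forall w, far a r w -> cmod (v w) <= M) -> cmod (z - a) < r ->
  qderiv (fun x => limavg f (far a r) (fun w => v w / (x - w))) z
         (- limavg f (far a r) (fun w => v w / (z - w) ^+ 2)).
Proof.
move=> r0 M0 hv hz; set d := r - cmod (z - a).
have d0 : 0 < d by rewrite subr_gt0.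
have hd w : far a r w -> d <= cmod (z - w) by exact: far_dist.
have d20 : 0 < d / 2 by rewrite divr_gt0.
have K0 : 0 <= M * (d^-1 ^+ 2 * (d / 2)^-1).
  by apply/mulr_ge0/mulr_ge0 => //; [apply: exprn_ge0|]; rewrite invr_ge0 ltW.
exists (M * (d^-1 ^+ 2 * (d / 2)^-1)) => //.
exists (d / 2) => // t td.
have hd2 w : far a r w -> d / 2 <= cmod (z + t - w).
  move=> /hd; have := cmodB (z + t - w) t.
  have -> : z + t - w - t = z - w by ring.
  lra.
have b0 x e : 0 < e -> (forall w, far a r w -> e <= cmod (x - w)) ->
    forall w, far a r w -> cmod (v w / (x - w)) <= M * e^-1.
  move=> e0 he w hw; rewrite cmodM ler_pM ?cmod_ge0 ?hv //.
  by apply: cmod_inv_le => //; exact: he.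
have b1 : forall w, far a r w -> cmod (v w / (z - w) ^+ 2) <= M * (d ^+ 2)^-1.
  move=> w hw; rewrite cmodM ler_pM ?cmod_ge0 ?hv //.
  by apply: cmod_inv_le; rewrite ?exprn_gt0 // cmodX lerXn2r ?nnegrE ?cmod_ge0 ?(ltW d0) ?hd.
have e1 := limavgD f (- 1) (b0 _ _ d20 hd2) (b0 _ _ d0 hd).
have b3 w : far a r w ->
    cmod (v w / (z + t - w) + - 1 * (v w / (z - w))) <= M * (d / 2)^-1 + M * d^-1.
  move=> hw; rewrite mulN1r; apply: le_trans (cmodB _ _) _.
  by apply: lerD; [exact: b0 hd2 _ hw|exact: b0 hd _ hw].
have e2 := limavgD f t b3 b1.
have -> : limavg f (far a r) (fun w => v w / (z + t - w)) -
    limavg f (far a r) (fun w => v w / (z - w)) -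
    t * (- limavg f (far a r) (fun w => v w / (z - w) ^+ 2)) =
    limavg f (far a r) (fun w => t ^+ 2 * (v w * ((z - w)^-1 ^+ 2 * (z + t - w)^-1))).
  rewrite mulrN opprK -[X in _ - X + _]mul1r -mulNr -e1 -e2.
  apply: limavg_ext => w hw.
  have z1 : z - w != 0 by rewrite -cmod_gt0; have := hd w hw; lra.
  have z2 : z + t - w != 0 by rewrite -cmod_gt0; have := hd2 w hw; lra.
  by field; rewrite z1 z2.
have tt0 : 0 <= cmod t ^+ 2 by rewrite exprn_ge0 ?cmod_ge0.
rewrite mulrC; apply: limavg_le => [|w hw].
  exact: mulr_ge0.
rewrite cmodM cmodX ler_wpM2l // cmodM ler_pM ?cmod_ge0 ?hv //.
rewrite cmodM cmodX ler_pM ?exprn_ge0 ?cmod_ge0 //.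
  by rewrite lerXn2r ?nnegrE ?invr_ge0 ?cmod_ge0 ?cmod_inv_le ?hd ?(ltW d0).
by apply: cmod_inv_le; rewrite ?hd2.
Qed.

End Averages.

(** * Clustering of roots and regularity of the limit gradient *)

Section Clusters.
Variable R : realType.
Variables (F : set_system nat) (FU : UltraFilter F).
Implicit Types (f : nat -> {poly C R}) (A : pred (C R)) (u v : C R -> C R).
Implicit Types (a b z w : C R) (U E : set (C R)) (N : C R -> nat) (r : R).

(** The averages are contractions for the sup norm, so u may vary with k. *)
Lemma avg_cvg_moving f A (uk : nat -> C R -> C R) u (M : R) :
  (forall w, A w -> cmod (u w) <= M) ->
  (forall e : R, 0 < e ->
     \forall k \near F, forall w, A w -> cmod (uk k w - u w) <= e) ->
  avg f A (uk k) k @[k --> F] --> limavg F f A u.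
Proof.
move=> hu huk; apply/cvg_cmodP => e e0.
have e2 : 0 < e / 2 by rewrite divr_gt0.
have /cvg_cmodP /(_ _ e2) h := limavg_cvg FU (f := f) hu.
apply: filterS2 (huk _ e2) h => k h1 h2.
have := cmod_triangle (avg f A u k) (avg f A (uk k) k) (limavg F f A u).
suff : cmod (avg f A (uk k) k - avg f A u k) <= e / 2 by lra.
have -> : avg f A (uk k) k - avg f A u k = avg f A (fun w => uk k w - u w) k.
  rewrite -mulN1r -avgD; apply: avg_ext => w _; ring.
by apply: avg_le => //; exact: ltW.
Qed.

Lemma avg_moving f z r (zk : nat -> C R) : 0 < r -> zk k @[k --> F] --> z ->
  avg f (far z r) (fun w => (zk k - w)^-1) k @[k --> F] -->
    limavg F f (far z r) (fun w => (z - w)^-1) /\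
  avg f (far z r) (fun w => (zk k - w)^-1 ^+ 2) k @[k --> F] -->
    limavg F f (far z r) (fun w => (z - w)^-1 ^+ 2).
Proof.
move=> r0 /cvg_cmodP hz.
have r20 : 0 < r / 2 by rewrite divr_gt0.
have b1 w : far z r w -> cmod (z - w)^-1 <= r^-1.
  by move=> hw; apply: cmod_inv_le => //; rewrite cmodC.
have b2 k w : cmod (zk k - z) < r / 2 -> far z r w ->
    cmod (zk k - w)^-1 <= (r / 2)^-1.
  move=> hk /(far_dist (zk k)) hw; apply: cmod_inv_le => //; lra.
have d1 k w : cmod (zk k - z) < r / 2 -> far z r w ->
    cmod ((zk k - w)^-1 - (z - w)^-1) <= cmod (zk k - z) * ((r / 2)^-1 * r^-1).
  move=> hk hw; have := far_dist (zk k) hw; have := far_dist z hw.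
  rewrite subrr cmod0 subr0 => h1 h2.
  have n1 : z - w != 0 by rewrite -cmod_gt0; lra.
  have n2 : zk k - w != 0 by rewrite -cmod_gt0; lra.
  have -> : (zk k - w)^-1 - (z - w)^-1 =
      - ((zk k - z) * ((zk k - w)^-1 * (z - w)^-1)) by field; rewrite n1 n2.
  by rewrite cmodN cmodM ler_wpM2l ?cmod_ge0 // cmodM ler_pM ?cmod_ge0 ?b1 ?b2.
have small (K e : R) : 0 < K -> 0 < e ->
    \forall k \near F, cmod (zk k - z) < r / 2 /\ cmod (zk k - z) * K <= e.
  move=> K0 e0; have m0 : 0 < Num.min (r / 2) (e / K).
    by rewrite lt_min r20 divr_gt0.
  apply: filterS (hz _ m0) => k; rewrite lt_min (ltr_pdivlMr _ _ K0) => /andP[h1 h2].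
  by split=> //; exact: ltW.
have K0 : 0 < (r / 2)^-1 * r^-1 by rewrite mulr_gt0 ?invr_gt0.
split.
  apply: (avg_cvg_moving (M := r^-1)) => // e e0.
  apply: filterS (small _ _ K0 e0) => k [h1 h2] w hw.
  exact: le_trans (d1 _ _ h1 hw) h2.
apply: (avg_cvg_moving (M := r^-1 ^+ 2)).
  by move=> w hw; rewrite cmodX lerXn2r ?nnegrE ?cmod_ge0 ?invr_ge0 ?(ltW r0) ?b1.
move=> e e0; have K1 : 0 < (r / 2)^-1 * r^-1 * ((r / 2)^-1 + r^-1).
  by rewrite mulr_gt0 // addr_gt0 ?invr_gt0.
apply: filterS (small _ _ K1 e0) => k [h1 h2] w hw.
rewrite subr_sqr cmodM; apply: le_trans _ h2; rewrite mulrA.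
rewrite ler_pM ?cmod_ge0 ?d1 //; apply: le_trans (cmodD _ _) _.
by rewrite lerD ?b1 ?b2.
Qed.

Definition deg_oo f := forall m, \forall k \near F, (m < (size (f k)).-1)%N.

(** N a is the number of roots that tend to a along F. Each of them eventually
    lies in any given disc about a, and no other root stays near a. *)
Definition clusters f U N := forall a, U a -> exists2 r, 0 < r &
  forall rho : R, 0 < rho -> rho <= r -> \forall k \near F, root_count (f k) a rho = N a.

Lemma root_count_gap (p : {poly C R}) a r1 r2 : r1 <= r2 -> root_count p a r1 = root_count p a r2 ->
  forall w, w \in poly_roots p -> cmod (w - a) < r2 -> cmod (w - a) < r1.
Proof.
move=> le12; rewrite /root_count; elim: (poly_roots p) => //= x s IH.
have le_s : (count (fun w => (cmod (w - a) < r1)%R) s <=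
             count (fun w => (cmod (w - a) < r2)%R) s)%N.
  by apply: sub_count => w /= h; exact: lt_le_trans h le12.
case: (ltP (cmod (x - a)) r1) => hx1.
  rewrite (lt_le_trans hx1 le12) => -[e] w; rewrite inE => /predU1P[-> //|].
  exact: IH.
case: (ltP (cmod (x - a)) r2) => hx2 e w.
  by move: le_s; rewrite add0n add1n in e; rewrite e ltnn.
rewrite inE => /predU1P[->|]; last exact: IH.
by rewrite ltNge hx2.
Qed.

Lemma root_count0_far (p : {poly C R}) a r : root_count p a r = 0%N ->
  forall w, w \in poly_roots p -> far a r w.
Proof.
rewrite /root_count /far => h w ws; rewrite leNgt; apply/negP => hw.
have : has (fun w => (cmod (w - a) < r)%R) (poly_roots p) by apply/hasP; exists w.
by rewrite has_count h.
Qed.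

Lemma far_root_count0 (p : {poly C R}) a r :
  (forall w, w \in poly_roots p -> far a r w) -> root_count p a r = 0%N.
Proof.
move=> h; apply/eqP; rewrite -leqn0 leqNgt -has_count; apply/hasP => -[w ws].
by have := h _ ws; rewrite /far leNgt => /negP.
Qed.

(** A root tending to z, at positive distance from a, would be one of the roots
    counted in the larger disc about a but not in a smaller one. *)
Lemma clusters_isolated f U N a r z : clusters f U N ->
  (forall rho : R, 0 < rho -> rho <= r -> \forall k \near F, root_count (f k) a rho = N a) ->
  U z -> z != a -> cmod (z - a) < r ->
  N z = 0%N /\ exists2 d, 0 < d & \forall k \near F, root_count (f k) z d = 0%N.
Proof.
move=> hN ha Uz za zr; have [r' r'0 hz] := hN _ Uz.
have d0 : 0 < cmod (z - a) by rewrite cmod_gt0 subr_eq0.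
pose e := Num.min r' (Num.min (cmod (z - a) / 2) (r - cmod (z - a))).
have e0 : 0 < e by rewrite !lt_min r'0 subr_gt0 zr divr_gt0.
have er' : e <= r' by rewrite ge_min lexx.
have ed : e <= cmod (z - a) / 2 by rewrite !ge_min lexx !orbT.
have er : e <= r - cmod (z - a) by rewrite !ge_min lexx !orbT.
have h0 : \forall k \near F, root_count (f k) z e = 0%N.
  have h1 : 0 < cmod (z - a) / 2 by rewrite divr_gt0.
  have h2 : cmod (z - a) / 2 <= r by lra.
  have h3 : 0 < r by lra.
  apply: filterS2 (ha _ h1 h2) (ha _ h3 (lexx _)) => k c1 c2.
  apply: far_root_count0 => w ws; rewrite /far leNgt; apply/negP => hw.
  have wr : cmod (w - a) < r.
    by have := cmod_triangle z w a; lra.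
  have := root_count_gap h2 (etrans c1 (esym c2)) ws wr.
  have := cmod_triangle w z a; rewrite (cmodC z w); lra.
split; last by exists e.
by have [k [<- ->]] := filter_ex (filterI (hz _ e0 er') h0).
Qed.

Lemma avg_all f A u k : (forall w, w \in poly_roots (f k) -> A w) ->
  avg f predT u k = avg f A u k.
Proof.
move=> h; rewrite /avg; congr (_ * _); rewrite big_seq_cond [RHS]big_seq_cond.
apply: eq_bigl => w; rewrite /= andbT; case: (boolP (w \in _)) => //= ws.
by rewrite h.
Qed.

Lemma inv_deg_small f (c e : R) : deg_oo f -> 0 < e ->
  \forall k \near F, c / (size (f k)).-1%:R < e.
Proof.
move=> hf e0.
have [m hm] : exists m : nat, `|c| / e < m%:R.
  by exists (Num.bound (`|c| / e)); apply: archi_boundP; rewrite divr_ge0 // ltW.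
apply: filterS (hf m) => k hk.
have n0 : (0 : R) < (size (f k)).-1%:R by rewrite ltr0n (leq_ltn_trans _ hk).
rewrite ltr_pdivrMr //; apply: le_lt_trans (ler_norm c) _.
rewrite mulrC -ltr_pdivrMr //; apply: lt_trans hm _; by rewrite ltr_nat.
Qed.

(** Finitely many terms, weighted by the inverse of a degree that tends to
    infinity. *)
Lemma avg_near_negligible f a r u (M : R) (m : nat) : deg_oo f -> 0 <= M ->
  (\forall k \near F, root_count (f k) a r = m) ->
  (\forall k \near F, forall w, w \in poly_roots (f k) -> cmod (w - a) < r ->
      cmod (u w) <= M) ->
  (avg f predT u k - avg f (far a r) u k) @[k --> F] --> (0 : C R).
Proof.
move=> hf M0 hm hM; apply/cvg_cmodP => e e0.
have h := inv_deg_small (m%:R * M) hf e0.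
apply: filterS3 hm hM h => k km kM; apply: le_lt_trans.
rewrite subr0 /avg -mulrBr (bigID (far a r) predT) /= addrAC subrr add0r.
rewrite cmodM cmodV cmod_nat mulrC ler_wpM2r ?invr_ge0 //.
apply: le_trans (cmod_sum _ _ _) _.
apply: (@le_trans _ _ (\sum_(w <- poly_roots (f k) | ~~ far a r w) M)).
  rewrite big_seq_cond [leRHS]big_seq_cond; apply: ler_sum => w /andP[ws].
  by rewrite /far -ltNge; exact: kM.
rewrite big_const_seq iter_addr_0 -(mulr_natl M) ler_wpM2r // ler_nat -km /root_count.
by apply: sub_count => w; rewrite /far -ltNge.
Qed.

Lemma cvg_subr0 (x y : nat -> C R) (l : C R) : x k @[k --> F] --> l ->
  (x k - y k) @[k --> F] --> (0 : C R) -> y k @[k --> F] --> l.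
Proof.
move=> hx hxy; have -> : y = fun k => x k - (x k - y k).
  by apply: funext => k; rewrite opprB addrC subrK.
by rewrite -[l]subr0; exact: (cvgB hx hxy).
Qed.

Lemma no_accumulationP U E a : no_accumulation_in U E -> U a ->
  exists2 r, 0 < r & forall z, z != a -> cmod (z - a) < r -> ~ E z.
Proof.
move=> hE Ua; have := hE _ Ua; rewrite /limit_point /= => /existsNP[V].
move=> /not_implyP [/nbhs_cmodP [r r0 hr] hV]; exists r => // z za zr Ez.
by apply: hV; exists z; split=> //; exact: hr.
Qed.

Lemma open_disc U a : open U -> U a -> exists2 r, 0 < r & forall z, cmod (z - a) < r -> U z.
Proof. by move=> oU Ua; apply/nbhs_cmodP; exact: open_nbhs_nbhs. Qed.

(** Near a, the function G is the limit of the part of f'/(n f) that comes from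
    the roots far from a; the N a remaining roots are too few to
    contribute to the limit. *)
Definition regular_at f U G N a := exists2 r, 0 < r &
  [/\ forall z, cmod (z - a) < r -> U z,
      forall rho : R, 0 < rho -> rho <= r -> \forall k \near F, root_count (f k) a rho = N a &
      forall z, cmod (z - a) < r ->
        G z = limavg F f (far a r) (fun w => (z - w)^-1)].

Lemma inv_qderiv f a r z : 0 < r -> cmod (z - a) < r ->
  qderiv (fun x => limavg F f (far a r) (fun w => (x - w)^-1)) z
         (- limavg F f (far a r) (fun w => (z - w)^-1 ^+ 2)).
Proof.
move=> r0 hz.
have := @cauchy_qderiv R F FU f a r (fun=> 1) 1 z r0 ler01.
have -> : (fun x => limavg F f (far a r) (fun w => 1 / (x - w))) =
          (fun x => limavg F f (far a r) (fun w => (x - w)^-1)).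
  by apply: funext => x; apply: limavg_ext => w _; rewrite mul1r.
have -> : limavg F f (far a r) (fun w => 1 / (z - w) ^+ 2) =
          limavg F f (far a r) (fun w => (z - w)^-1 ^+ 2).
  by apply: limavg_ext => w _; rewrite mul1r exprVn.
by apply=> //; move=> w _; rewrite cmod1.
Qed.

(** At a point z close to a but distinct from it, roots eventually keep away
    from z, so the far part alone has limit G z. At a itself, and only
    there, compare G with the limit of the far part by continuity of both. *)
Lemma regularity f U E G N : deg_oo f -> open U -> clusters f U N ->
  no_accumulation_in U E -> (forall z, U z -> {for z, continuous G}) ->
  (forall b, U b -> ~ E b -> N b = 0%N ->
     avg f predT (fun w => (b - w)^-1) k @[k --> F] --> G b) ->
  forall a, U a -> regular_at f U G N a.
Proof.
move=> hf oU hN hE cG hG a Ua.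
have [r1 r10 h1] := hN _ Ua; have [r2 r20 h2] := no_accumulationP hE Ua.
have [r3 r30 h3] := open_disc oU Ua.
pose r := Num.min r1 (Num.min r2 r3).
have r0 : 0 < r by rewrite !lt_min r10 r20.
have rr1 : r <= r1 by rewrite ge_min lexx.
have rr2 : r <= r2 by rewrite !ge_min lexx !orbT.
have rr3 : r <= r3 by rewrite !ge_min lexx !orbT.
have hU z : cmod (z - a) < r -> U z by move=> h; apply: h3; exact: lt_le_trans h rr3.
have hc rho : 0 < rho -> rho <= r -> \forall k \near F, root_count (f k) a rho = N a.
  by move=> p0 pr; apply: h1 => //; exact: le_trans pr rr1.
have punct z : z != a -> cmod (z - a) < r ->
    G z = limavg F f (far a r) (fun w => (z - w)^-1).
  move=> za zr; have [Nz [d d0 hd]] := clusters_isolated hN hc (hU _ zr) za zr.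
  have := hG _ (hU _ zr) (h2 _ za (lt_le_trans zr rr2)) Nz.
  have dV : 0 <= d^-1 by rewrite invr_ge0 ltW.
  have hb : \forall k \near F, forall w, w \in poly_roots (f k) ->
      cmod (w - a) < r -> cmod (z - w)^-1 <= d^-1.
    apply: filterS hd => k hk w ws _; apply: cmod_inv_le => //.
    by rewrite cmodC; exact: root_count0_far hk _ ws.
  have := avg_near_negligible hf dV (hc _ r0 (lexx _)) hb.
  move=> n1 n2; apply/esym/limavg_eq.
  pose u w : C R := (z - w)^-1.
  exact: (cvg_subr0 n2 n1).
exists r => //; split=> // z zr; have [->|za] := eqVneq z a; last exact: punct.
apply/eqP; rewrite -subr_eq0; apply/eqP/cmod_eps => e e0.
have e2 : 0 < e / 2 by rewrite divr_gt0.
have ar : cmod (a - a) < r by rewrite subrr cmod0.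
have [K K0 [d d0 hK]] := qderiv_lip (inv_qderiv f r0 ar).
have /nbhs_cmodP [d' d'0 hd'] : \forall z \near a, cmod (G z - G a) < e / 2.
  by have /cvg_cmodP := cG _ Ua; exact.
pose t := Num.min (Num.min (d / 2) (d' / 2)) (Num.min (r / 2) (e / 2 / (K + 1))).
have K10 : 0 < K + 1 by lra.
have t0 : 0 < t by rewrite !lt_min !divr_gt0.
have t1 : t <= d / 2 by rewrite !ge_min lexx.
have t2 : t <= d' / 2 by rewrite !ge_min lexx !orbT.
have t3 : t <= r / 2 by rewrite !ge_min lexx !orbT.
have t4 : t * (K + 1) <= e / 2 by rewrite -ler_pdivlMr // !ge_min lexx !orbT.
have ct : cmod (t%:C : C R) = t by rewrite cmod_realp // ltW.
have at0 : a + t%:C - a = t%:C by rewrite addrAC subrr add0r.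
have p1 : G (a + t%:C) = limavg F f (far a r) (fun w => (a + t%:C - w)^-1).
  apply: punct; last by rewrite at0 ct; lra.
  by rewrite -subr_eq0 at0 -cmod_gt0 ct.
have p2 : cmod (G (a + t%:C) - G a) < e / 2.
  by apply: hd'; rewrite at0 ct; lra.
have p3 := hK t%:C; rewrite ct -p1 in p3.
have {}p3 : cmod (G (a + t%:C) - limavg F f (far a r) (fun w => (a - w)^-1)) <= K * t.
  by apply: p3; lra.
have := cmod_triangle (G (a + t%:C)) (G a) (limavg F f (far a r) (fun w => (a - w)^-1)).
rewrite (cmodC (G a) (G (a + t%:C))); lra.
Qed.

End Clusters.

(** * Zeros of the limit gradient and the effect of one derivation *)

Section Step.
Variable R : realType.
Variables (F : set_system nat) (FU : UltraFilter F).
Implicit Types (f : nat -> {poly C R}) (A : pred (C R)) (u v : C R -> C R).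
Implicit Types (a b z w : C R) (U E : set (C R)) (N : C R -> nat) (r : R).
Implicit Types (G g h : C R -> C R).

(** The order s comes with a bound for the logarithmic derivative of the
    regular factor g, so that (z - a) G'/G is close to s near a. *)
Definition zero_factor G a (s : nat) := exists g h, exists2 K : R, 0 <= K &
  exists2 r, 0 < r & forall z, cmod (z - a) < r ->
    [/\ G z = (z - a) ^+ s * g z, g z != 0, qderiv g z (h z) &
        cmod (h z) <= K * cmod (g z)].

(** With v_s(w) = (w - a)^-s, the limits g_s(z) of the averages of v_s(w)/(z - w)
    satisfy G = g_0 and g_s(z) = g_s(a) + (z - a) g_(s+1)(z). So
    G = (z - a)^s g_s for the first s with g_s(a) != 0. If there is none, then
    |G(z)| <= (|z - a|/r)^s/(r - |z - a|) for all s, and G = 0 near a. *)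
Lemma zero_factor_exists f U G N a : regular_at F f U G N a ->
  (forall r, 0 < r -> exists2 z, cmod (z - a) < r & G z != 0) ->
  exists s, zero_factor G a s.
Proof.
move=> [r r0 [_ _ hG]] hnz.
pose v s w : C R := (w - a)^-1 ^+ s.
pose g s z := limavg F f (far a r) (fun w => v s w / (z - w)).
have aa : cmod (a - a) < r by rewrite subrr cmod0.
have rV : 0 <= r^-1 by rewrite invr_ge0 ltW.
have hv s w : far a r w -> cmod (v s w) <= r^-1 ^+ s.
  move=> hw; rewrite cmodX lerXn2r ?nnegrE ?cmod_ge0 //.
  exact: cmod_inv_le.
have hM s : 0 <= r^-1 ^+ s by rewrite exprn_ge0.
have dist z w : far a r w -> r - cmod (z - a) <= cmod (z - w) by exact: far_dist.
have hb s z : cmod (z - a) < r -> forall w, far a r w ->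
    cmod (v s w / (z - w)) <= r^-1 ^+ s / (r - cmod (z - a)).
  move=> zr w hw; rewrite cmodM ler_pM ?cmod_ge0 ?hv //.
  by apply: cmod_inv_le; rewrite ?subr_gt0 ?dist.
have g0 z : cmod (z - a) < r -> G z = g 0%N z.
  move=> zr; rewrite hG //; apply: limavg_ext => w _.
  by rewrite /v expr0 mul1r.
have grec s z : cmod (z - a) < r -> g s z = g s a + (z - a) * g s.+1 z.
  move=> zr; rewrite /g -(limavgD FU f _ (hb s a aa) (hb s.+1 z zr)).
  apply: limavg_ext => w hw; rewrite /v exprS.
  have n1 : z - w != 0.
    by rewrite -cmod_gt0 (lt_le_trans _ (dist z _ hw)) // subr_gt0.
  have n2 : a - w != 0.
    by rewrite -cmod_gt0 (lt_le_trans _ (dist a _ hw)) // subr_gt0.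
  have n3 : w - a != 0 by rewrite -opprB oppr_eq0.
  by move: (_ ^+ s) => y; field; rewrite n1 n2 n3.
have gpow s : (forall i, (i < s)%N -> g i a = 0) ->
    forall z, cmod (z - a) < r -> G z = (z - a) ^+ s * g s z.
  elim: s => [|s IH] hs z zr; first by rewrite expr0 mul1r g0.
  rewrite (IH _ z zr); last by move=> i /ltnW; exact: hs.
  by rewrite (grec _ _ zr) hs // add0r exprS; ring.
have [hex|hall] := pselect (exists s, g s a != 0); last first.
  exfalso; have [z zr /eqP[]] := hnz _ r0.
  apply: cmod_eps => e e0.
  have d0 : 0 < r - cmod (z - a) by rewrite subr_gt0.
  have x1 : `|cmod (z - a) / r| < 1.
    by rewrite ger0_norm ?divr_ge0 ?cmod_ge0 ?ltW // ltr_pdivrMr // mul1r.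
  have /cvgrPdist_lt /(_ _ (mulr_gt0 e0 d0)) := @cvg_expr R _ x1.
  move=> [n _ /(_ n (leqnn n))] /=; rewrite sub0r normrN => hn.
  rewrite (gpow n) //; last first.
    by move=> i _; apply/eqP/negP => /negP h; apply: hall; exists i.
  have := limavg_le FU f (divr_ge0 (hM n) (ltW d0)) (hb n z zr).
  move=> hg; rewrite cmodM cmodX.
  apply: (@le_trans _ _ (cmod (z - a) ^+ n * (r^-1 ^+ n / (r - cmod (z - a))))).
    by rewrite ler_wpM2l ?exprn_ge0 ?cmod_ge0.
  rewrite mulrA -exprMn ler_pdivrMr //; apply: ltW; apply: le_lt_trans hn.
  exact: ler_norm.
pose s := ex_minn hex.
have [hs hmin] : g s a != 0 /\ forall i, (i < s)%N -> g i a = 0.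
  rewrite /s; case: ex_minnP => m hm hmin; split=> // i im.
  by apply/eqP; apply: contraTT im => /hmin; rewrite -leqNgt.
exists s, (g s), (fun z => - limavg F f (far a r) (fun w => v s w / (z - w) ^+ 2)).
have qd z : cmod (z - a) < r -> qderiv (g s) z
   (- limavg F f (far a r) (fun w => v s w / (z - w) ^+ 2)).
  by move=> zr; apply: cauchy_qderiv zr => //; exact: hv.
pose c := cmod (g s a); have c0 : 0 < c by rewrite cmod_gt0.
have r20 : 0 < r / 2 by rewrite divr_gt0.
have r2V : 0 <= (r / 2)^-1 by rewrite invr_ge0 ltW.
pose B := r^-1 ^+ s * (r / 2)^-1 ^+ 2.
have B0 : 0 <= B by rewrite mulr_ge0 ?exprn_ge0.
exists (B / (c / 2)); first by rewrite divr_ge0 // ltW // divr_gt0.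
have [L L0 [d d0 hL]] := qderiv_lip (qd _ aa).
have L1 : 0 < L + 1 by lra.
exists (Num.min (r / 2) (Num.min d (c / 2 / (L + 1)))).
  by rewrite !lt_min r20 d0 !divr_gt0.
move=> z; rewrite !lt_min (ltr_pdivlMr _ _ L1) => /and3P[z1 z2 z3].
have zr : cmod (z - a) < r by lra.
have gz : c / 2 <= cmod (g s z).
  have := hL _ z2; rewrite (addrC a) subrK => h.
  have := cmodB (g s z) (g s z - g s a); rewrite opprB addrCA subrr addr0.
  have := cmod_ge0 (z - a); rewrite -/c; nra.
split; [exact: gpow|by rewrite -cmod_gt0; lra|exact: qd|].
have hB : cmod (- limavg F f (far a r) (fun w => v s w / (z - w) ^+ 2)) <= B.
  rewrite cmodN; apply: limavg_le => // w hw.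
  rewrite cmodM /B ler_pM ?cmod_ge0 ?hv // -exprVn cmodX.
  rewrite lerXn2r ?nnegrE ?cmod_ge0 //; apply: cmod_inv_le => //.
  by have := dist z w hw; lra.
apply: le_trans hB _; rewrite mulrAC ler_pdivlMr ?divr_gt0 //.
by rewrite ler_wpM2l.
Qed.

Lemma size_derivC (p : {poly C R}) : size p^`() = (size p).-1.
Proof.
case E : (size p) => [|[|n]].
- by move/eqP: E; rewrite size_poly_eq0 => /eqP ->; rewrite derivC size_poly0.
- have /size1_polyC -> : (size p <= 1)%N by rewrite E.
  by rewrite derivC size_poly0.
have p0 : p != 0 by rewrite -size_poly_eq0 E.
apply/eqP; rewrite eqn_leq -ltnS -E lt_size_deriv //= E /=.
rewrite ltnNge; apply/negP => /(nth_default 0)/eqP.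
have := lead_coef_eq0 p; rewrite coef_deriv mulrn_eq0 /= /lead_coef E /= => ->.
exact/negP.
Qed.

Lemma deg_oo_deriv f : deg_oo F f -> deg_oo F (fun k => (f k)^`()).
Proof.
move=> hf m; apply: filterS (hf m.+1) => k; rewrite size_derivC.
by case: (size (f k)).-1.
Qed.

Lemma inv_deg_cvg f : deg_oo F f ->
  ((size (f k)).-1%:R)^-1 @[k --> F] --> (0 : C R).
Proof.
move=> hf; apply/cvg_cmodP => e e0.
apply: filterS (inv_deg_small _ 1 hf e0) => k.
by rewrite subr0 cmodV cmod_nat div1r.
Qed.

Lemma cvg_near_eq (x y : nat -> C R) (l : C R) :
  (\forall k \near F, x k = y k) -> x k @[k --> F] --> l -> y k @[k --> F] --> l.
Proof. by move=> e; apply: cvg_trans; exact: near_eq_cvg. Qed.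

Lemma cvg_Ndiv (x y : nat -> C R) (l m : C R) :
  x k @[k --> F] --> l -> y k @[k --> F] --> m -> m != 0 ->
  (- (x k / y k)) @[k --> F] --> - l / m.
Proof.
by move=> hx hy m0; rewrite mulNr; exact: (cvgN (cvgM hx (cvgV m0 hy))).
Qed.

Lemma cvg_mulp (x y : nat -> C R) (l m : C R) :
  x k @[k --> F] --> l -> y k @[k --> F] --> m ->
  (x k * y k) @[k --> F] --> l * m.
Proof. exact: cvgM. Qed.

Lemma cvg_subp (x y : nat -> C R) (l m : C R) :
  x k @[k --> F] --> l -> y k @[k --> F] --> m ->
  (x k - y k) @[k --> F] --> l - m.
Proof. exact: cvgB. Qed.

Lemma cvg_subc (x : nat -> C R) (l c : C R) :
  x k @[k --> F] --> l -> (x k - c) @[k --> F] --> l - c.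
Proof. by move=> hx; exact: (cvgB hx (cvg_cst c)). Qed.

Lemma cvg_addM (x y d : nat -> C R) (l m : C R) :
  x k @[k --> F] --> l -> y k @[k --> F] --> m -> d k @[k --> F] --> (0 : C R) ->
  (x k + d k * (x k + y k)) @[k --> F] --> l.
Proof.
move=> hx hy hd; rewrite -[l]addr0 -[in X in _ + X](mul0r (l + m)).
exact: (cvgD hx (cvgM hd (cvgD hx hy))).
Qed.

Lemma avg_invsum f k z :
  avg f predT (fun w => (z - w)^-1) k =
  ((size (f k)).-1%:R)^-1 * invsum 1 (poly_roots (f k)) z.
Proof. by []. Qed.

Lemma avg_invsum2 f k z :
  avg f predT (fun w => (z - w)^-1 ^+ 2) k =
  ((size (f k)).-1%:R)^-1 * invsum 2 (poly_roots (f k)) z.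
Proof. by rewrite /avg /invsum; under eq_bigr do rewrite exprVn. Qed.

(** The points zk vary with k because the convergence is needed uniformly on
    a circle, and along an ultrafilter that is convergence along every sequence
    of points of the circle. *)
Lemma logder_moving f U G N z (zk : nat -> C R) : deg_oo F f ->
  regular_at F f U G N z -> N z = 0%N -> G z != 0 -> zk k @[k --> F] --> z ->
  exists2 D, qderiv G z D &
  [/\ avg f predT (fun w => (zk k - w)^-1) k @[k --> F] --> G z,
      (invsum 1 (poly_roots (f k)^`()) (zk k) - invsum 1 (poly_roots (f k)) (zk k))
         @[k --> F] --> D / G z,
      \forall k \near F, (f k).[zk k] != 0 &
      \forall k \near F, (f k)^`().[zk k] != 0].
Proof.
move=> hf [r r0 [_ hc hG]] Nz Gz hzk.
have zz : cmod (z - z) < r by rewrite subrr cmod0.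
have [m1 m2] := avg_moving FU f r0 hzk.
set L2 := limavg F f (far z r) (fun w => (z - w)^-1 ^+ 2) in m2.
exists (- L2).
  apply: (eq_qderiv r0 _ (inv_qderiv FU f r0 zz)) => w hw.
  by rewrite hG.
have hfar : \forall k \near F, forall w, w \in poly_roots (f k) -> far z r w.
  by apply: filterS (hc _ r0 (lexx _)) => k; rewrite Nz; exact: root_count0_far.
have hn : \forall k \near F, f k != 0.
  apply: filterS (hf 0%N) => k; apply: contraTneq => ->.
  by rewrite size_poly0.
have hnz : \forall k \near F, (f k).[zk k] != 0.
  have /cvg_cmodP /(_ _ r0) hr := hzk.
  apply: filterS3 hfar hn hr => k h1 h2 h3.
  rewrite root_poly_roots //; apply/negP => /h1; rewrite /far; lra.
have c1 : avg f predT (fun w => (zk k - w)^-1) k @[k --> F] --> G z.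
  rewrite (hG z zz); apply: (cvg_near_eq _ m1).
  by apply: filterS hfar => k h; apply/esym/avg_all.
have c2 : avg f predT (fun w => (zk k - w)^-1 ^+ 2) k @[k --> F] --> L2.
  apply: (cvg_near_eq _ m2).
  by apply: filterS hfar => k h; apply/esym/avg_all.
have a0 : \forall k \near F, avg f predT (fun w => (zk k - w)^-1) k != 0.
  have g0 : 0 < cmod (G z) by rewrite cmod_gt0.
  have /cvg_cmodP /(_ _ g0) := c1; apply: filterS => k; apply: contraTneq => ->.
  by rewrite sub0r cmodN ltxx.
have hd : \forall k \near F, (f k)^`().[zk k] != 0.
  apply: filterS2 hnz a0 => k h1; rewrite avg_invsum mulf_eq0 negb_or => /andP[_ h2].
  by rewrite logder1 // mulf_neq0.
split; [exact: c1| |exact: hnz|exact: hd].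
have hT := cvg_Ndiv c2 c1 Gz.
apply: (cvg_near_eq _ hT).
apply: filterS3 hnz hd (filterI a0 (hf 0%N)) => k h1 h2 [h3 h4].
rewrite logder_deriv // avg_invsum avg_invsum2.
have n0 : ((size (f k)).-1%:R : C R) != 0 by rewrite pnatr_eq0 -lt0n.
have s0 : invsum 1 (poly_roots (f k)) (zk k) != 0.
  by apply: contraNneq h3 => e; rewrite avg_invsum e mulr0.
by field; rewrite n0 s0.
Qed.

(** f''/((n-1) f') = Q + (Q + Q'/Q)/(n-1) for Q = f'/(n f). *)
Lemma deriv_avg f U G N b : deg_oo F f ->
  regular_at F f U G N b -> N b = 0%N -> G b != 0 ->
  avg (fun k => (f k)^`()) predT (fun w => (b - w)^-1) k @[k --> F] --> G b.
Proof.
move=> hf hr Nb Gb.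
have [D _ [c1 c2 _ _]] := logder_moving hf hr Nb Gb (cvg_cst b).
have hi := inv_deg_cvg (deg_oo_deriv hf).
apply: (cvg_near_eq _ (cvg_addM c1 c2 hi)).
apply: filterS2 (hf 0%N) (hf 1%N) => k n0 n1.
rewrite !avg_invsum size_derivC.
case: (size (f k)).-1 n0 n1 => // n _; rewrite ltnS => n1 /=.
have h0 : (n%:R : C R) != 0 by rewrite pnatr_eq0 -lt0n.
have h1 : (1 + n%:R : C R) != 0 by rewrite nat1r pnatr_eq0.
rewrite -nat1r; field; rewrite h0 h1 //.
Qed.

(** On a small circle about a, (z - a)(f''/f' - f'/f) is eventually within 1/2 of
    s: otherwise there are bad points zk on the circle, which
    converge to some z there, and at z the limit (z - a) G'/G is within 1/4
    of s. *)
Lemma deriv_clusters f U G N s a : deg_oo F f ->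
  (forall a, U a -> regular_at F f U G N a) -> U a -> clusters F f U N ->
  zero_factor G a s ->
  exists2 r, 0 < r & forall rho, 0 < rho -> rho <= r ->
    \forall k \near F, root_count (f k)^`() a rho = (N a + s)%N.
Proof.
move=> hf hreg Ua hN [g [h [K K0 [r1 r10 hfac]]]].
have [r2 r20 [hU hc _]] := hreg _ Ua.
have K40 : 0 < 4 * K + 1 by lra.
(* The last bound makes rho * K, hence |(z - a) G'/G - s|, at most 1/4 on the
   circle of radius rho. *)
pose r := Num.min (Num.min r1 r2 / 2) (4 * K + 1)^-1.
have r0 : 0 < r by rewrite lt_min invr_gt0 K40 divr_gt0 // lt_min r10.
exists r => // rho p0 pr.
have pm : rho <= Num.min r1 r2 / 2 by apply: le_trans pr _; rewrite ge_min lexx.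
have p1 : rho < r1.
  have : Num.min r1 r2 <= r1 by rewrite ge_min lexx.
  lra.
have p2 : rho < r2.
  have : Num.min r1 r2 <= r2 by rewrite ge_min lexx orbT.
  lra.
have pK : rho * K <= 1 / 4.
  have : rho <= (4 * K + 1)^-1 by apply: le_trans pr _; rewrite ge_min lexx orbT.
  rewrite -[X in _ <= X]div1r ler_pdivlMr //; lra.
pose good k z := [/\ (f k).[z] != 0, (f k)^`().[z] != 0 &
   cmod ((z - a) * (invsum 1 (poly_roots (f k)^`()) z - invsum 1 (poly_roots (f k)) z)
      - s%:R) <= 1 / 2].
have hgood : \forall k \near F, forall z, cmod (z - a) = rho -> good k z.
  have [//|bad] := in_ultra_setVsetC
     [set k | forall z, cmod (z - a) = rho -> good k z] FU.
  exfalso.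
  (* The default value a is taken only at indices outside the ultrafilter. *)
  pose zk k := xget a [set z | cmod (z - a) = rho /\ ~ good k z].
  have hzk : \forall k \near F, cmod (zk k - a) = rho /\ ~ good k (zk k).
    apply: filterS bad => k /= /existsNP[z] /not_implyP[z1 z2].
    rewrite /zk; case: xgetP => [x _ //|hx]; by case: (hx z).
  clearbody zk.
  have hcl : \forall k \near F, [set z | cmod (z - a) <= rho] (zk k).
    by apply: filterS hzk => k [/= ->].
  have [z /= zle hz] := ultra_cvg_compact (@compact_disc _ a rho) hcl.
  have za : cmod (z - a) = rho.
    apply/le_anti; rewrite zle /= leNgt; apply/negP => zlt.
    have e0 : 0 < rho - cmod (z - a) by rewrite subr_gt0.
    have /cvg_cmodP /(_ _ e0) h1 := hz.
    have [k [h2 [h3 _]]] := filter_ex (filterI h1 hzk).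
    have := cmod_triangle z (zk k) a; lra.
  have za0 : z - a != 0 by rewrite -cmod_gt0 za.
  have zna : z != a by rewrite -subr_eq0.
  have zr2 : cmod (z - a) < r2 by rewrite za.
  have zr1 : cmod (z - a) < r1 by rewrite za.
  have Uz := hU _ zr2.
  have [Nz _] := clusters_isolated FU hN hc Uz zna zr2.
  have [Gz gz qg hgK] := hfac _ zr1.
  have Gz0 : G z != 0 by rewrite Gz mulf_neq0 // expf_neq0.
  have [D qD [_ c2 n1 n2]] := logder_moving hf (hreg _ Uz) Nz Gz0 hz.
  have [D' qD' hD'] := qderiv_Xsub_pow a s qg.
  have eD : D = D'.
    apply: (qderiv_uniq qD); have d0 : 0 < r1 - rho by rewrite subr_gt0.
    apply: (eq_qderiv d0 _ qD') => w hw; apply/esym.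
    have wr1 : cmod (w - a) < r1 by have := cmod_triangle z w a; lra.
    by have [] := hfac _ wr1.
  have hsmall : cmod ((z - a) * (D / G z) - s%:R) <= 1 / 4.
    have -> : (z - a) * (D / G z) - s%:R = (z - a) * (h z / g z).
      rewrite mulrA eD hD' Gz.
      have n0 : (z - a) ^+ s != 0 by rewrite expf_neq0.
      by move: ((z - a) ^+ s) n0 => y y0; field; rewrite y0 gz.
    rewrite cmodM za; apply: le_trans pK; rewrite ler_wpM2l ?(ltW p0) //.
    by rewrite cmodM cmodV ler_pdivrMr // cmod_gt0.
  have hza : (zk k - a) @[k --> F] --> z - a by exact: (cvg_subc hz).
  have e4 : (0 : R) < 1 / 4 by lra.
  have /cvg_cmodP /(_ _ e4) hT  := cvg_mulp hza c2.
  have [k [[[_ nb] n1k] [n2k hTk]]] :=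
    filter_ex (filterI (filterI hzk n1) (filterI n2 hT)).
  apply: nb; split=> //.
  have := cmod_triangle ((z - a) * (D / G z))
    ((zk k - a) * (invsum 1 (poly_roots (f k)^`()) (zk k) -
                   invsum 1 (poly_roots (f k)) (zk k))) s%:R.
  move: hTk hsmall; lra.
apply: filterS2 hgood (hc _ p0 (ltW p2)) => k hk <-.
have hn : forall z, cmod (z - a) = rho -> f k != 0 /\ (f k)^`() != 0.
  by move=> z /hk [h1 h2 _]; split;
    [apply: contraNneq h1|apply: contraNneq h2] => ->; rewrite horner0.
apply: circle_count => // [w ws|w ws|z hz].
- apply/eqP => hw; have [_ /negP[]] := hk _ hw.
  by rewrite root_poly_roots //; have [] := hn _ hw.
- apply/eqP => hw; have [/negP[]] := hk _ hw.
  by rewrite root_poly_roots //; have [] := hn _ hw.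
- by have [] := hk _ hz.
Qed.

End Step.

(** * Sums over roots and divisors *)

Section Sums.
Variable R : realType.
Variables (F : set_system nat) (FU : UltraFilter F).
Implicit Types (f : nat -> {poly C R}) (A : pred (C R)) (u v : C R -> C R).
Implicit Types (a b z w : C R) (U E : set (C R)) (N : C R -> nat) (r : R).

(** If the set were infinite, the sets containing all but finitely many of its
    points would form a proper filter, with a cluster point in K. *)
Lemma compact_isolated_finite (K P : set (C R)) : compact K ->
  (forall a, K a -> exists2 r, 0 < r &
     forall z, K z -> z != a -> cmod (z - a) < r -> ~ P z) ->
  finite_set (K `&` P).
Proof.
move=> cK hK; apply: contrapT => inf.
pose H : set_system (C R) := [set A | finite_set ((K `&` P) `\` A)].
have HH : ProperFilter H.
  split; first by rewrite /H /= setD0.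
  split; first by rewrite /H /= setDT; exact: finite_set0.
    move=> A B hA hB; apply: (@sub_finite_set _ _
       (((K `&` P) `\` A) `|` ((K `&` P) `\` B))); last by rewrite finite_setU.
    by move=> x [KP /not_andP[]]; [left|right].
  by move=> A B AB; apply: sub_finite_set => x [KP nB]; split=> // /AB.
have [|a [Ka clu]] := cK H HH.
  by apply: (sub_finite_set _ (finite_set0 _)) => x [[Kx _] nK]; exact: nK.
have [r r0 hr] := hK _ Ka.
have [||z [[[Kz Pz] za] zr]] := clu ((K `&` P) `\` [set a]) [set z | cmod (z - a) < r].
- apply: (sub_finite_set _ (finite_set1 a)) => x [KP /not_andP[//|]].
  by move=> /contrapT.
- by apply/nbhs_cmodP; exists r.
by apply: (hr z) => //; apply/eqP.
Qed.

Lemma seq_radius (T : eqType) (s : seq T) (P : T -> R -> Prop) :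
  (forall b : T, b \in s -> exists2 r, 0 < r & forall rho, 0 < rho -> rho <= r -> P b rho) ->
  exists2 r, 0 < r & forall rho, 0 < rho -> rho <= r -> forall b : T, b \in s -> P b rho.
Proof.
elim: s => [_|x s IH h]; first by exists 1.
have [r1 r10 h1] := h x (mem_head _ _).
have [|r2 r20 h2] := IH; first by move=> b bs; apply: h; rewrite inE bs orbT.
exists (Num.min r1 r2); first by rewrite lt_min r10.
move=> rho p0; rewrite le_min => /andP[p1 p2] b; rewrite inE => /predU1P[->|].
  exact: h1.
exact: h2.
Qed.

Lemma near_seq (T : eqType) (s : seq T) (P : T -> nat -> Prop) :
  (forall b : T, b \in s -> \forall k \near F, P b k) ->
  \forall k \near F, forall b : T, b \in s -> P b k.
Proof.
elim: s => [_|x s IH h]; first by near=> k.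
have h1 := h x (mem_head _ _).
have h2 : \forall k \near F, forall b : T, b \in s -> P b k.
  by apply: IH => b bs; apply: h; rewrite inE bs orbT.
apply: filterS2 h1 h2 => k p1 p2 b; rewrite inE => /predU1P[->//|]; exact: p2.
Unshelve. all: by end_near. Qed.

(** Otherwise roots in K far from S would converge to a point of K, at which
    some root clusters. *)
Lemma roots_near_clusters f U N (K : set (C R)) (S : seq (C R)) r :
  clusters F f U N -> compact K -> K `<=` U ->
  (forall b, K b -> N b != 0%N -> b \in S) -> 0 < r ->
  \forall k \near F, forall w, w \in poly_roots (f k) -> K w ->
    exists2 b, b \in S & cmod (w - b) < r.
Proof.
move=> hN cK KU hS r0.
have [//|bad] := in_ultra_setVsetC [set k | forall w, w \in poly_roots (f k) ->
   K w -> exists2 b, b \in S & cmod (w - b) < r] FU.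
exfalso.
pose zk k := xget 0 [set w | [/\ w \in poly_roots (f k), K w &
   ~ exists2 b, b \in S & cmod (w - b) < r]].
have hzk : \forall k \near F, [/\ zk k \in poly_roots (f k), K (zk k) &
   ~ exists2 b, b \in S & cmod (zk k - b) < r].
  apply: filterS bad => k /= /existsNP[z] /not_implyP[z1 /not_implyP[z2 z3]].
  by rewrite /zk; case: xgetP => [x _ //|hx]; case: (hx z).
clearbody zk.
have hK : \forall k \near F, K (zk k) by apply: filterS hzk => k [].
have [l Kl hl] := ultra_cvg_compact cK hK.
have /cvg_cmodP hl' := hl.
have [Nl|Nl] := eqVneq (N l) 0%N.
  have [d d0 hd] := hN _ (KU _ Kl).
  have [k [[h1 h2] [h3 _ _]]] := filter_ex (filterI (filterI (hd _ d0 (lexx _)) (hl' _ d0)) hzk).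
  by rewrite Nl in h1; have := root_count0_far h1 h3; rewrite /far leNgt h2.
have [k [h1 [_ _ h2]]] := filter_ex (filterI (hl' _ r0) hzk).
by apply: h2; exists l => //; exact: hS.
Qed.

(** The roots that matter are partitioned by the discs about the points of S; the
    disc about b contains N b of them, at which phi is close to phi b. *)
Lemma clusters_sum f U N (phi : C R -> C R) (S : seq (C R)) :
  clusters F f U N -> test_function U phi -> uniq S ->
  (forall b, b \in S -> closure [set z | phi z != 0] b) ->
  (forall b, closure [set z | phi z != 0] b -> N b != 0%N -> b \in S) ->
  (\sum_(w <- poly_roots (f k)) phi w) @[k --> F] --> \sum_(b <- S) phi b *+ N b.
Proof.
move=> hN [cphi cK KU] uS SK hS; set K := closure _ in cK KU SK hS.
apply/cvg_cmodP => e e0.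
pose M : R := \sum_(b <- S) (N b)%:R.
have M0 : 0 <= M by apply: sumr_ge0.
(* Each of the M roots near S accounts for an error of at most eta. *)
pose eta := e / (M + 1); have M1 : 0 < M + 1 by lra.
have eta0 : 0 < eta by rewrite divr_gt0.
have [|r r0 hr] := @seq_radius _ S (fun b rho =>
  [/\ \forall k \near F, root_count (f k) b rho = N b,
      forall w, cmod (w - b) < rho -> cmod (phi w - phi b) <= eta &
      forall b', b' \in S -> b' != b -> rho * 2 <= cmod (b' - b)]).
  move=> b bS; have [r1 r10 h1] := hN _ (KU _ (SK _ bS)).
  have /cvg_cmodP /(_ _ eta0) /nbhs_cmodP [r2 r20 h2] := cphi b.
  have [|r3 r30 h3] := @seq_radius _ S (fun b' rho => b' != b -> rho * 2 <= cmod (b' - b)).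
    move=> b' _; have [->|nb] := eqVneq b' b; first by exists 1.
    exists (cmod (b' - b) / 2); first by rewrite divr_gt0 // cmod_gt0 subr_eq0.
    move=> rho p0 pr _; lra.
  exists (Num.min r1 (Num.min r2 r3)); first by rewrite !lt_min r10 r20.
  move=> rho p0; rewrite !le_min => /and3P[p1 p2 p3]; split.
  - exact: h1.
  - by move=> w hw; apply: ltW; apply: h2; exact: lt_le_trans hw p2.
  - by move=> b' b'S; apply: h3.
have {}hr := hr r r0 (lexx r).
have h1 : \forall k \near F, forall b, b \in S -> root_count (f k) b r = N b.
  by apply: near_seq => b /hr [].
apply: filterS2 h1 (roots_near_clusters hN cK KU hS r0) => k h2 h3.
have split_sum : \sum_(w <- poly_roots (f k)) phi w =
    \sum_(b <- S) \sum_(w <- poly_roots (f k) | cmod (w - b) < r) phi w.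
  under [RHS]eq_bigr do rewrite big_mkcond.
  rewrite exchange_big /=; apply: eq_big_seq => w ws.
  have [p0|p0] := eqVneq (phi w) 0.
    by rewrite p0 big1 // => b' _; case: ifP.
  have [|b bS wb] := h3 w ws; first exact: subset_closure.
  rewrite (big_rem b) //= wb big_seq big1 ?addr0 // => b'.
  rewrite mem_rem_uniq // inE => /andP[nb b'S]; case: ifP => // wb'; exfalso.
  have [_ _ /(_ _ b'S nb)] := hr _ bS.
  by have := cmod_triangle w b' b; rewrite (cmodC b' w); lra.
rewrite split_sum -sumrB; apply: le_lt_trans (cmod_sum _ _ _) _.
apply: (@le_lt_trans _ _ (M * eta)); last first.
  by rewrite /eta mulrA ltr_pdivrMr //; lra.
rewrite /M mulr_suml big_seq [leRHS]big_seq; apply: ler_sum => b bS.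
have [_ hphi _] := hr _ bS.
have -> : phi b *+ N b = \sum_(w <- poly_roots (f k) | cmod (w - b) < r) phi b.
  by rewrite big_const_seq iter_addr_0 -(h2 _ bS).
rewrite -sumrB; apply: le_trans (cmod_sum _ _ _) _.
apply: (@le_trans _ _ (\sum_(w <- poly_roots (f k) | cmod (w - b) < r) eta)).
  by apply: ler_sum => w; exact: hphi.
by rewrite big_const_seq iter_addr_0 -(mulr_natl eta) -(h2 _ bS).
Qed.

End Sums.

Section ZeroOrders.
Variable R : realType.
Implicit Types (f : {poly C R}) (g h : C R -> C R) (a b z w : C R).

Lemma derivable_hornerC f z : derivable (fun w => f.[w]) z 1.
Proof.
elim/poly_ind: f => [|f c IH].
  have -> : (fun w => (0 : {poly C R}).[w]) = cst 0.
    by apply: funext => w; rewrite horner0.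
  exact: derivable_cst.
have -> : (fun w => (f * 'X + c%:P).[w]) = (fun w => f.[w]) * id + cst c.
  by apply: funext => w; rewrite hornerMXaddC.
apply: derivableD; last exact: derivable_cst.
by apply: derivableM; [exact: IH|exact: derivable_id].
Qed.

Lemma has_zero_order_poly f z : f != 0 ->
  has_zero_order (fun w => f.[w]) z (count_mem z (poly_roots f)).
Proof.
move=> f0; pose g := lead_coef f *: \prod_(w <- poly_roots f | w != z) ('X - w%:P).
exists (fun w => g.[w]); split.
- by near=> w; exact: derivable_hornerC.
- rewrite hornerZ mulf_neq0 ?lead_coef_eq0 // horner_prod.
  rewrite -big_filter prodf_seq_neq0; apply/allP => w; rewrite mem_filter.
  by move=> /andP[wz _]; rewrite /= hornerXsubC subr_eq0 eq_sym.
- near=> w; rewrite {1}(poly_rootsE f) /g !hornerZ mulrCA; congr (_ * _).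
  rewrite (bigID (pred1 z)) /= hornerM; congr (_ * _).
  rewrite horner_prod (eq_bigr (fun=> w - z)).
    by rewrite big_const_seq -Monoid.iteropE.
  by move=> x /eqP ->; rewrite hornerXsubC.
Unshelve. all: by end_near. Qed.

(** If m < n then the two expressions give g = (w - z)^(n - m) h off z, and the
    right-hand side is at most a multiple of |w - z|. *)
Lemma has_zero_order_uniq (f : C R -> C R) z m n :
  has_zero_order f z m -> has_zero_order f z n -> m = n.
Proof.
wlog lemn : m n / (m <= n)%N => [hw hm hn|].
  by case: (leqP m n) => [|/ltnW] h; [exact: hw|apply/esym/hw].
move=> [g [dg gz hg]] [h [dh hz hh]].
apply/eqP; rewrite eqn_leq lemn leqNgt; apply/negP => ltmn.
have cg : g w @[w --> z] --> g z.
  apply/differentiable_continuous/derivable1_diffP.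
  exact: nbhs_singleton dg.
have ch : h w @[w --> z] --> h z.
  apply/differentiable_continuous/derivable1_diffP.
  exact: nbhs_singleton dh.
have /eqP := gz; apply.
have /nbhs_cmodP [r1 r10 h1] : \forall w \near z,
    (w - z) ^+ m * g w = (w - z) ^+ n * h w.
  by near=> w; rewrite -(near hg w) // -(near hh w).
apply: cmod_eps => e e0.
have e2 : 0 < e / 2 by rewrite divr_gt0.
have /cvg_cmodP /(_ _ e2) /nbhs_cmodP [r2 r20 h2] := cg.
have /cvg_cmodP /(_ _ ltr01) /nbhs_cmodP [r3 r30 h3] := ch.
pose B := cmod (h z) + 1; have B0 : 0 < B by rewrite ltr_wpDl ?cmod_ge0.
pose t := Num.min (Num.min 1 (e / 2 / B)) (Num.min r1 (Num.min r2 r3) / 2).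
have t0 : 0 < t by rewrite !lt_min ltr01 !divr_gt0 // !lt_min r10 r20.
have t1 : t <= 1 by rewrite !ge_min lexx.
have t2 : t * B <= e / 2 by rewrite -ler_pdivlMr // !ge_min lexx !orbT.
have tm : t <= Num.min r1 (Num.min r2 r3) / 2 by rewrite !ge_min lexx !orbT.
have tr1 : t < r1.
  by have := ge_min r1 r1 (Num.min r2 r3); rewrite lexx /= => ?; lra.
have tr2 : t < r2.
  have : Num.min r1 (Num.min r2 r3) <= r2 by rewrite !ge_min lexx !orbT.
  lra.
have tr3 : t < r3.
  have : Num.min r1 (Num.min r2 r3) <= r3 by rewrite !ge_min lexx !orbT.
  lra.
have ct : cmod (t%:C : C R) = t by rewrite cmod_realp // ltW.
pose w := z + t%:C.
have wz : w - z = t%:C by rewrite /w addrAC subrr add0r.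
have tc0 : (t%:C : C R) != 0 by rewrite -cmod_gt0 ct.
have := h1 w; rewrite wz ct => /(_ tr1).
rewrite -(subnK lemn) addnC exprD -mulrA => /(mulfI (expf_neq0 m tc0)) gw.
have k0 : (0 < n - m)%N by rewrite subn_gt0.
have := h2 w; rewrite wz ct => /(_ tr2) k2.
have := h3 w; rewrite wz ct => /(_ tr3) k3.
have hB : cmod (h w) <= B.
  have := cmodD (h w - h z) (h z); rewrite subrK /B; lra.
have : cmod (g w) <= t * B.
  rewrite gw cmodM cmodX ct ler_pM ?exprn_ge0 ?cmod_ge0 ?(ltW t0) //.
  by apply: ler_iXnr; rewrite ?(ltW t0).
have := cmodB (g w) (g w - g z); rewrite opprB addrCA subrr addr0; lra.
Unshelve. all: by end_near. Qed.

Lemma zero_orderE (f : C R -> C R) z n : has_zero_order f z n -> zero_order f z = n.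
Proof.
move=> h; rewrite /zero_order; case: xgetP => [m _ hm|/(_ n)//].
exact: has_zero_order_uniq hm h.
Qed.

Lemma zero_divisor_poly f z : f != 0 ->
  zero_divisor (fun w => f.[w]) z = count_mem z (poly_roots f).
Proof. by move=> f0; rewrite /zero_divisor (zero_orderE (has_zero_order_poly z f0)). Qed.

Lemma zero_factor_order (G : C R -> C R) a s : zero_factor G a s -> has_zero_order G a s.
Proof.
move=> [g [h [K K0 [r r0 H]]]]; exists g; split.
- apply/nbhs_cmodP; exists r => // z /H [_ _ hq _]; exact: qderiv_derivable hq.
- by have [] := H a; rewrite ?subrr ?cmod0.
- by apply/nbhs_cmodP; exists r => // z /H [].
Qed.

Lemma sum_count_mem (phi : C R -> C R) (s rs : seq (C R)) : uniq s ->
  {subset rs <= s} ->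
  \sum_(z <- s) phi z *~ (count_mem z rs)%:Z = \sum_(w <- rs) phi w.
Proof.
move=> us; elim: rs => [_|w rs IH hs].
  by rewrite big_nil big1 // => z _; rewrite mulr0z.
rewrite big_cons -IH; last by move=> x xs; apply: hs; rewrite inE xs orbT.
under eq_bigr do rewrite /= PoszD mulrzDr.
rewrite big_split /=; congr (_ + _).
rewrite (big_rem w) ?hs ?mem_head //= eqxx mulr1z big_seq big1 ?addr0 // => z.
by rewrite mem_rem_uniq // inE eq_sym => /andP[/negPf -> _]; rewrite mulr0z.
Qed.

Lemma pairing_poly (U : set (C R)) (phi : C R -> C R) (f g : {poly C R}) : f != 0 -> g != 0 ->
  (forall z, ~ U z -> phi z = 0) ->
  divisor_pairing U (fun z => zero_divisor (fun w => f.[w]) z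
                              - zero_divisor (fun w => g.[w]) z) phi =
  \sum_(w <- poly_roots f) phi w - \sum_(w <- poly_roots g) phi w.
Proof.
move=> f0 g0 hphi; rewrite /divisor_pairing.
pose s := undup (poly_roots f ++ poly_roots g).
rewrite (@fsbig_widen _ _ _ _ U setT) //; last first.
  by move=> z [_ /hphi /= ->]; rewrite mul0rz.
rewrite (fsbigE s) ?undup_uniq //; last first.
  move=> z _; rewrite mem_undup mem_cat negb_or => /andP[zf zg].
  by rewrite !zero_divisor_poly // (count_memPn zf) (count_memPn zg) subrr mulr0z.
rewrite (eq_bigl predT); last by move=> z; rewrite in_setT.
under eq_bigr do rewrite !zero_divisor_poly // mulrzBr.
rewrite sumrB !sum_count_mem ?undup_uniq // => z zs.
  by rewrite mem_undup mem_cat zs orbT.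
by rewrite mem_undup mem_cat zs.
Qed.

End ZeroOrders.

(** * The potential of a root distribution *)

Section Potential.
Variable R : realType.
Implicit Types (q : {poly C R}) (z w : C R).

Definition log_dist z w : \bar R := lne (cmod (z - w))%:E.

(** The sets of points w where log_dist z w exceeds a real number are open. *)
Lemma log_dist_measurable z :
  measurable_fun [set: borelC R] (log_dist z).
Proof.
apply: (measurability _ (ErealGenOInfty.measurableE R)) => _ [_ [r ->] <-].
rewrite setTI; apply: sub_sigma_algebra.
have lt_log w : (r%:E < log_dist z w)%E = (expR r < cmod (z - w)).
  rewrite /log_dist; have [d0|d0] := ltP 0 (cmod (z - w)).
    by rewrite lne_EFin // lte_fin -[in LHS]ltr_expR lnK // posrE.
  rewrite le0_lneNy // ltNge leNye /=; apply/esym/negbTE; rewrite -leNgt.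
  exact: le_trans d0 (expR_ge0 r).
rewrite /= openE => w /=; rewrite in_itv /= andbT lt_log => hw.
apply/nbhs_cmodP; exists (cmod (z - w) - expR r); first by rewrite subr_gt0.
move=> v hv /=; rewrite in_itv /= andbT lt_log.
by have := cmod_triangle v z w; lra.
Qed.

Lemma integral_roots q (f : borelC R -> \bar R) :
  measurable_fun [set: borelC R] f -> (forall w, (0 <= f w)%E) ->
  (\int[root_distribution q]_w f w =
    (((size q).-1%:R : R)^-1)%:E * \sum_(w <- poly_roots q) f w)%E.
Proof.
move=> mf f0; rewrite /root_distribution ge0_integral_mscale //=.
rewrite ge0_integral_measure_sum //; congr (_ * _)%E.
rewrite (big_nth 0) big_mkord; apply: eq_bigr => i _.
by rewrite integral_dirac // diracT mul1e.
Qed.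

(** The integral of a function of variable sign is the difference of two
    integrals; they may not be recombined at a root, where the second one is
    infinite. *)
Lemma potentialE q z :
  potential (root_distribution q) z =
  ((((size q).-1%:R : R)^-1)%:E * \sum_(w <- poly_roots q) (log_dist z)^\+%E w -
   (((size q).-1%:R : R)^-1)%:E * \sum_(w <- poly_roots q) (log_dist z)^\-%E w)%E.
Proof.
have mf := log_dist_measurable z.
rewrite /potential integralE !integral_roots //.
- exact: measurable_funeneg.
- exact: measurable_funepos.
Qed.

Definition log_mean q z : R :=
  ((size q).-1%:R)^-1 * \sum_(w <- poly_roots q) ln (cmod (z - w)).

Lemma potential_nonroot q z : q != 0 -> q.[z] != 0 ->
  potential (root_distribution q) z = (log_mean q z)%:E.
Proof.
move=> q0; rewrite root_poly_roots // => zq; rewrite potentialE.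
have E w : w \in poly_roots q -> log_dist z w = (ln (cmod (z - w)))%:E.
  move=> wq; rewrite /log_dist lne_EFin // cmod_gt0 subr_eq0.
  by apply: contraNneq zq => ->.
have -> : (\sum_(w <- poly_roots q) (log_dist z)^\+ w)%E =
    (\sum_(w <- poly_roots q) Num.max (ln (cmod (z - w))) 0)%:E.
  rewrite -sumEFin; apply: eq_big_seq => w /E h.
  by rewrite funeposE h EFin_max.
have -> : (\sum_(w <- poly_roots q) (log_dist z)^\- w)%E =
    (\sum_(w <- poly_roots q) Num.max (- ln (cmod (z - w))) 0)%:E.
  rewrite -sumEFin; apply: eq_big_seq => w /E h.
  by rewrite funenegE h EFin_max.
rewrite -!EFinM -EFinB -mulrBr -sumrB /log_mean; congr ((_ * _)%:E).
apply: eq_bigr => w _; move: (ln _) => x.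
by rewrite /Num.max; do 2 case: ltP => ?; lra.
Qed.

Lemma potential_root q z : (0 < (size q).-1)%N -> q.[z] == 0 ->
  potential (root_distribution q) z = -oo%E.
Proof.
move=> n0; have q0 : q != 0 by apply: contraTneq n0 => ->; rewrite size_poly0.
rewrite root_poly_roots // => zq; rewrite potentialE.
have c0 : (0 < ((size q).-1%:R : R)^-1)%R by rewrite invr_gt0 ltr0n.
have -> : (\sum_(w <- poly_roots q) (log_dist z)^\- w)%E = +oo%E.
  rewrite (big_rem z) //= funenegE /log_dist subrr cmod0 le0_lneNy //=.
  rewrite addye // -ltNye; apply: (@lt_le_trans _ _ 0%E); first by rewrite ltNyr.
  by apply: sume_ge0 => w _; exact: funeneg_ge0.
rewrite gt0_muley ?lte_fin // addeNy //.
Qed.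

End Potential.

(** * From convergence of potentials to the gradient *)

Section Initial.
Variable R : realType.
Implicit Types (a b z w t : C R) (U E : set (C R)) (N : C R -> nat) (r : R).

(** 2 ln|1 + u| = ln(1 + x) with x = 2 Re u + |u|^2, and ln(1 + x) lies between
    x - 4 x^2 and x for x >= -3/4. The value 13 is not optimal. *)
Lemma ln_cmod1D (u : C R) : cmod u <= 1 / 2 ->
  `|ln (cmod (1 + u)) - complex.Re u| <= 13 * cmod u ^+ 2.
Proof.
move=> hu; have u0 := cmod_ge0 u.
pose x := complex.Re u * 2 + cmod u ^+ 2.
have hRe := Re_le_cmod u.
have h1 : 1 / 2 <= cmod (1 + u).
  by have := cmodB (1 + u) u; rewrite addrK cmod1; lra.
have sq : cmod (1 + u) ^+ 2 = 1 + x.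
  rewrite /x !cmod_sqr; case: (u) => p q /=; ring.
have x1 : 1 / 4 <= 1 + x.
  by rewrite -sq; move: h1; rewrite expr2; nra.
have l2 : ln (1 + x) = ln (cmod (1 + u)) * 2.
  by rewrite -sq lnXn ?mulr_natr //; lra.
have up : ln (1 + x) <= x by apply: le_ln1Dx; lra.
have lo : x - 4 * x ^+ 2 <= ln (1 + x).
  have y0 : 0 < 1 + x by lra.
  have := @le_ln1Dx R ((1 + x)^-1 - 1).
  have -> : 1 + ((1 + x)^-1 - 1) = (1 + x)^-1 by ring.
  rewrite lnV ?posrE // ltrBrDr addNr invr_gt0 => /(_ y0) h.
  (* The lower bound is the upper bound applied to the inverse of 1 + x. *)
  have e : 1 - (1 + x)^-1 = x / (1 + x) by field; rewrite gt_eqF.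
  have : x - 4 * x ^+ 2 <= x / (1 + x).
    rewrite ler_pdivlMr //; have := sqr_ge0 x; move: x1; rewrite expr2; nra.
  lra.
have xb : x ^+ 2 <= (5 / 2 * cmod u) ^+ 2.
  rewrite -[x ^+ 2]real_normK ?num_real // lerXn2r ?nnegrE //; first by lra.
  rewrite /x; apply: le_trans (ler_normD _ _) _; rewrite normrM.
  rewrite (@ger0_norm _ 2) // (@ger0_norm _ (cmod u ^+ 2)) ?exprn_ge0 //.
  rewrite expr2; nra.
rewrite ler_norml; apply/andP; split; move: lo up xb; rewrite l2 /x !expr2; nra.
Qed.

(** Sum [ln_cmod1D] over the roots w, with u = t/(b - w). *)
Lemma log_mean_taylor (q : {poly C R}) b t r : 0 < r ->
  (forall w, w \in poly_roots q -> far b r w) -> cmod t <= r / 2 ->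
  `|log_mean q (b + t) - log_mean q b -
    complex.Re (t * (((size q).-1%:R)^-1 * invsum 1 (poly_roots q) b))|
    <= 13 / r ^+ 2 * cmod t ^+ 2.
Proof.
move=> r0 hfar tr.
have [q0|q0] := eqVneq (size q).-1 0%N.
  have -> : complex.Re (t * (((size q).-1%:R)^-1 * invsum 1 (poly_roots q) b)) = 0.
    by rewrite q0 invr0 mul0r mulr0.
  rewrite /log_mean q0 invr0 !mul0r !subr0 normr0 mulr_ge0 ?exprn_ge0 ?cmod_ge0 //.
  by rewrite divr_ge0 // exprn_ge0 // ltW.
set n : R := (size q).-1%:R.
have n0 : 0 < n by rewrite ltr0n lt0n.
have qn0 : q != 0 by apply: contraNneq q0 => ->; rewrite size_poly0.
have ReM (s : R) z : complex.Re (s%:C * z) = s * complex.Re z.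
  by case: z => p' q' /=; rewrite mul0r subr0.
have Resum (s : seq (C R)) (v : C R -> C R) :
    complex.Re (\sum_(w <- s) v w) = \sum_(w <- s) complex.Re (v w).
  elim: s => [|x s IH]; first by rewrite !big_nil.
  by rewrite !big_cons -IH; case: (v x) => ? ?; case: (\sum_(_ <- _) _).
have -> : complex.Re (t * ((size q).-1%:R^-1 * invsum 1 (poly_roots q) b)) =
    n^-1 * \sum_(w <- poly_roots q) complex.Re (t / (b - w)).
  rewrite mulrCA.
  have -> : ((size q).-1%:R^-1 : C R) = (n^-1)%:C.
    by rewrite /n rmorphV ?unitfE ?gt_eqF // rmorph_nat.
  by rewrite ReM /invsum mulr_sumr Resum.
rewrite /log_mean -/n -mulrBr -mulrBr -!sumrB normrM normfV (gtr0_norm n0).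
rewrite mulrC ler_pdivrMr //; apply: le_trans (ler_norm_sum _ _ _) _.
apply: (@le_trans _ _ (\sum_(w <- poly_roots q) 13 / r ^+ 2 * cmod t ^+ 2)).
  rewrite big_seq [leRHS]big_seq; apply: ler_sum => w /hfar hw.
  have bw : r <= cmod (b - w) by rewrite cmodC.
  have bw0 : b - w != 0 by rewrite -cmod_gt0; lra.
  have u2 : cmod (t / (b - w)) <= cmod t / r.
    rewrite cmodM cmodV ler_wpM2l ?cmod_ge0 // lef_pV2 ?posrE //; lra.
  have u1 : cmod (t / (b - w)) <= 1 / 2.
    by apply: le_trans u2 _; rewrite ler_pdivrMr //; lra.
  have -> : b + t - w = (b - w) * (1 + t / (b - w)) by field; exact: bw0.
  have u3 : 0 < cmod (1 + t / (b - w)).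
    by have := cmodB (1 + t / (b - w)) (t / (b - w)); rewrite addrK cmod1; lra.
  rewrite cmodM lnM ?posrE ?cmod_gt0 // -?cmod_gt0 //.
  have cancel (x y v : R) : x + y - x - v = y - v by ring.
  rewrite cancel.
  apply: le_trans (ln_cmod1D u1) _.
  have -> : 13 / r ^+ 2 * cmod t ^+ 2 = 13 * (cmod t / r) ^+ 2.
    by rewrite expr_div_n; field; rewrite gt_eqF.
  rewrite ler_wpM2l // lerXn2r ?nnegrE ?cmod_ge0 //.
  by rewrite divr_ge0 ?cmod_ge0 // ltW.
rewrite big_const_seq iter_addr_0 count_predT size_poly_roots //.
by rewrite -(mulr_natr (13 / r ^+ 2 * cmod t ^+ 2)).
Qed.

Lemma derive1_quad (phi : R -> R) (x D K d : R) : 0 <= K -> 0 < d ->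
  (forall s : R, `|s| < d -> `|phi (x + s) - phi x - s * D| <= K * s ^+ 2) ->
  derive1 phi x = D.
Proof.
move=> K0 d0 H; rewrite /derive1; apply: (@cvg_lim R^o) => //.
apply/cvgrPdist_lt => e e0.
have hm : 0 < Num.min d (e / (K + 1)) by rewrite lt_min d0 divr_gt0 //; lra.
near=> h.
have h0 : h != 0 by near: h; exact: nbhs_dnbhs_neq.
have : `|h| < Num.min d (e / (K + 1)).
  near: h; apply: dnbhs0_lt; exact: hm.
rewrite lt_min => /andP[hd he].
have ah : 0 < `|h| by rewrite normr_gt0.
have -> : D - h^-1 *: (phi (h + x) - phi x) = - (h^-1 * (phi (x + h) - phi x - h * D)).
  by rewrite [h + x]addrC /GRing.scale /=; field.
rewrite normrN normrM normfV mulrC ltr_pdivrMr //.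
apply: le_lt_trans (H _ hd) _; rewrite -real_normK ?num_real // expr2 mulrA.
rewrite ltr_pM2r //; move: he; rewrite ltr_pdivlMr; last by lra.
have := normr_ge0 h; nra.
Unshelve. all: by end_near. Qed.

(** Take t real, then purely imaginary: Re (i s L) = - s Im L. *)
Lemma quad_gradient (p : C R -> R) b (L : C R) (K d : R) : 0 <= K -> 0 < d ->
  (forall t, cmod t < d -> `|p (b + t) - p b - complex.Re (t * L)| <= K * cmod t ^+ 2) ->
  complex_gradient p b = L.
Proof.
move=> K0 d0 H; case: b L H => x y [L1 L2] H; rewrite /complex_gradient.
have -> : pderivx p (x +i* y) = L1.
  apply: (derive1_quad K0 d0) => s hs /=.
  have := H s%:C; rewrite cmod_real real_normK ?num_real // => /(_ hs).
  have -> : (x +i* y : C R) + s%:C = (x + s) +i* y by congr Complex; rewrite addr0.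
  have -> // : complex.Re (s%:C * (L1 +i* L2) : C R) = s * L1.
  by rewrite /= mul0r subr0.
have -> : pderivy p (x +i* y) = - L2.
  apply: (derive1_quad K0 d0) => s hs /=.
  have cs : cmod (0 +i* s : C R) = `|s|.
    by rewrite /cmod normc_def /= expr0n add0r sqrtr_sqr.
  have := H (0 +i* s); rewrite cs real_normK ?num_real // => /(_ hs).
  have -> : (x +i* y : C R) + (0 +i* s) = x +i* (y + s) by congr Complex; rewrite addr0.
  have -> // : complex.Re ((0 +i* s) * (L1 +i* L2) : C R) = s * - L2.
  by rewrite /= mul0r sub0r mulrN.
by rewrite opprK.
Qed.

Lemma derive1_zero_const (phi : R -> R) (x y : R) :
  (forall s, Num.min x y <= s <= Num.max x y -> derivable phi s 1 /\ derive1 phi s = 0) ->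
  phi x = phi y.
Proof.
wlog xy : x y / x <= y => [hw H|].
  case: (leP x y) => [|/ltW] h; first exact: hw.
  by apply/esym/hw => // s; rewrite minC maxC; exact: H.
rewrite (min_idPl xy) (max_idPr xy) => H.
have [||s hs] := @MVT_segment R phi (fun=> 0) x y xy.
- move=> s hs; have [h1 h2] : derivable phi s 1 /\ derive1 phi s = 0.
    by apply: H; move: hs; rewrite in_itv /= => /andP[/ltW -> /ltW ->].
  by apply: DeriveDef => //; rewrite -derive1E.
- apply: derivable_within_continuous => s hs.
  by have [] := H s; first by move: hs; rewrite in_itv.
by rewrite mul0r => /eqP; rewrite subr_eq0 => /eqP.
Qed.

(** Go from a to z along a horizontal segment and then a vertical one; both stay in
    the disc. *)
Lemma gradient_zero_const U (p : C R -> R) a r : open U -> C1_on U p -> 0 < r ->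
  (forall z, cmod (z - a) < r -> U z /\ complex_gradient p z = 0) ->
  forall z, cmod (z - a) < r -> p z = p a.
Proof.
move=> oU hp r0 H [x y] hz; case: a H hz => a1 a2 H hz.
have inbox (s1 s2 : R) : `|s1 - a1| <= `|x - a1| -> `|s2 - a2| <= `|y - a2| ->
    cmod ((s1 +i* s2 : C R) - (a1 +i* a2)) < r.
  move=> h1 h2; apply: le_lt_trans hz.
  rewrite -(@ler_pXn2r _ 2) ?nnegrE ?cmod_ge0 // !cmod_sqr /=.
  by apply: lerD; rewrite -real_normK ?num_real // -[leRHS]real_normK ?num_real //
     lerXn2r ?nnegrE.
have dz z : cmod (z - (a1 +i* a2)) < r -> pderivx p z = 0 /\ pderivy p z = 0.
  by move=> /H [_]; rewrite /complex_gradient => -[-> /eqP]; rewrite oppr_eq0 => /eqP.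
transitivity (p (x +i* a2)).
  apply: (@derive1_zero_const (fun s => p (x +i* s))) => s hs.
  have hc : cmod ((x +i* s : C R) - (a1 +i* a2)) < r.
    apply: inbox => //; move: hs.
    rewrite /Num.min /Num.max; case: ltP => hh /andP[h1 h2].
      by rewrite !ler0_norm; lra.
    by rewrite !ger0_norm; lra.
  have [Uz _] := H _ hc; have [_ h2] := dz _ hc.
  by have [_ h3 _ _] := hp _ Uz.
apply: (@derive1_zero_const (fun s => p (s +i* a2))) => s hs.
have hc : cmod ((s +i* a2 : C R) - (a1 +i* a2)) < r.
  apply: inbox; last by rewrite subrr normr0.
  move: hs; rewrite /Num.min /Num.max; case: ltP => hh /andP[h1 h2].
    by rewrite !ler0_norm; lra.
  by rewrite !ger0_norm; lra.
have [Uz _] := H _ hc; have [h2 _] := dz _ hc.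
by have [h3 _ _ _] := hp _ Uz.
Qed.

End Initial.

(** * Convergence of the zero divisors of derivatives *)

Section Main.
Variable R : realType.
Implicit Types (a b z w t : C R) (U E : set (C R)) (N : C R -> nat) (r : R).
Implicit Types (q : nat -> {poly C R}).

Lemma root_counting_measureE (f : {poly C R}) (A : set (C R)) :
  root_counting_measure f A = ((count (fun w => w \in A) (poly_roots f))%:R : R)%:E.
Proof.
rewrite /root_counting_measure /= /msum.
rewrite (eq_bigr (fun i : 'I__ => ((nth 0 (poly_roots f) i \in A)%:R : R)%:E)).
  rewrite sumEFin; congr EFin.
  rewrite -(big_mkord predT (fun i => ((nth 0 (poly_roots f) i \in A)%:R : R))).
  rewrite -(big_nth 0 predT (fun w => ((w \in A)%:R : R))).
  elim: (poly_roots f) => [|w s IH]; first by rewrite big_nil.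
  by rewrite big_cons IH /= natrD.
by move=> i _; exact: diracE.
Qed.

Lemma ultra_bounded_nat (F : set_system nat) (FU : UltraFilter F) (u : nat -> nat) m :
  (\forall k \near F, (u k <= m)%N) -> exists c, \forall k \near F, u k = c.
Proof.
elim: m => [|m IH] h.
  by exists 0%N; apply: filterS h => k; rewrite leqn0 => /eqP.
have [h1|h1] := in_ultra_setVsetC [set k | (u k <= m)%N] FU; first exact: IH.
exists m.+1; apply: filterS2 h h1 => k h2 /= /negP; rewrite -ltnNge => h3.
by apply/eqP; rewrite eqn_leq h2.
Qed.

Lemma root_count_mono (f : {poly C R}) a r1 r2 : r1 <= r2 -> (root_count f a r1 <= root_count f a r2)%N.
Proof. by move=> h; apply: sub_count => w /= h1; exact: lt_le_trans h1 h. Qed.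

(** Root counts in small discs about a are bounded, so each is eventually
    constant along F. As a function of the radius this constant is
    nondecreasing, so it is constant below the radius where it is least. *)
Lemma clusters_exist (F : set_system nat) (FU : UltraFilter F) q U :
  \oo `<=` F -> open U -> root_sparse q U -> exists N, clusters F q U N.
Proof.
move=> sF oU sp.
suff H a : exists n, U a -> exists2 r, 0 < r &
  forall rho : R, 0 < rho -> rho <= r -> \forall k \near F, root_count (q k) a rho = n.
  by have [N hN] := choice H; exists N.
have [Ua|nUa] := pselect (U a); last by exists 0%N.
have [r r0 hr] := open_disc oU Ua.
have r20 : 0 < r / 2 by rewrite divr_gt0.
have [|M hM] := sp _ (@compact_disc _ a (r / 2)).
  by move=> z /= hz; apply: hr; lra.
have [m hm] : exists m : nat, `|M| < m%:R.
  by exists (Num.bound `|M|); exact: archi_boundP.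
have bnd : \forall k \near F, (root_count (q k) a (r / 2) <= m)%N.
  apply: sF; apply: filterS hM => k; rewrite root_counting_measureE lee_fin => h.
  have : (count (fun w => w \in [set z : C R | (cmod (z - a) <= r / 2)%R]) (poly_roots (q k))
     <= m)%N.
    rewrite -(ler_nat R); apply: le_trans h _; apply: le_trans (ler_norm M) _.
    exact: ltW.
  by apply: leq_trans; apply: sub_count => w /= hw; rewrite inE /= ltW.
have ev rho : 0 < rho -> rho <= r / 2 -> exists c, \forall k \near F, root_count (q k) a rho = c.
  move=> p0 pr; apply: (ultra_bounded_nat FU (m := m)).
  by apply: filterS bnd => k; apply: leq_trans; exact: root_count_mono.
pose P c := `[< exists2 rho : R, 0 < rho <= r / 2 &
   \forall k \near F, root_count (q k) a rho = c >].
have exP : exists c, P c.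
  have [c hc] := ev _ r20 (lexx _); exists c; apply/asboolP.
  by exists (r / 2); rewrite ?r20 ?lexx.
case: (ex_minnP exP) => c /asboolP[r1 /andP[r10 r1r] hc] hmin.
exists c => _; exists r1 => // rho p0 pr.
have [c' hc'] := ev _ p0 (le_trans pr r1r).
suff <- : c' = c by [].
apply/eqP; rewrite eqn_leq; apply/andP; split.
  have [k [<- <-]] := filter_ex (filterI hc' hc); exact: root_count_mono.
apply: hmin; apply/asboolP; exists rho => //.
by rewrite p0 (le_trans pr r1r).
Qed.

Lemma gradient_continuous U (p : C R -> R) z : C1_on U p -> U z ->
  {for z, continuous (complex_gradient p)}.
Proof.
move=> hp /hp [_ _ cx cy]; rewrite /continuous_at /complex_gradient.
exact: (cvg_ReIm cx (cvgN cy)).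
Qed.

Lemma gradient_nonzero U (p : C R -> R) a : open U -> C1_on U p ->
  nowhere_locally_constant U p -> U a ->
  forall r, 0 < r -> exists2 z, cmod (z - a) < r & complex_gradient p z != 0.
Proof.
move=> oU hp nc Ua r r0; apply: contrapT => hno.
have [r1 r10 hr1] := open_disc oU Ua.
pose d := Num.min r r1; have d0 : 0 < d by rewrite lt_min r0.
have aa : cmod (a - a) < d by rewrite subrr cmod0.
have oD : open [set z | cmod (z - a) < d].
  rewrite openE => z /= hz; apply/nbhs_cmodP; exists (d - cmod (z - a)).
    by rewrite subr_gt0.
  by move=> w hw /=; have := cmod_triangle z w a; lra.
have dU z : cmod (z - a) < d -> U z.
  by rewrite lt_min => /andP[_ h]; exact: hr1.
apply: (nc [set z | cmod (z - a) < d]) => //; first by exists a.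
exists (p a); apply: (gradient_zero_const oU hp d0) => z hz; split; first exact: dU.
apply/eqP/negP => /negP h; apply: hno; exists z => //.
by move: hz; rewrite lt_min => /andP[].
Qed.

(** A root in A would make the potential -oo, so uniform convergence also
    says that A is eventually free of roots, and log_mean is the potential. *)
Lemma potential_cvg (N2 : set nat) (F : set_system nat) (A : set (C R)) q
    (d : nat -> R) (p : C R -> R) : Filter F -> within N2 \oo `<=` F ->
  (forall k, (0 < (size (q k)).-1)%N) ->
  unif_cvg_on (within N2 \oo) A
    (fun k z => (d k)%:E + potential (root_distribution (q k)) z)%E p ->
  forall e : R, 0 < e -> \forall k \near F, forall z, A z ->
    `|d k + log_mean (q k) z - p z| < e.
Proof.
move=> FF sF dq h e e0; apply: sF; apply: filterS (h e e0) => k hk z Az.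
have := hk z Az; have q0 : q k != 0.
  by apply: contraTneq (dq k) => ->; rewrite size_poly0.
have [z0|z0] := boolP ((q k).[z] == 0).
  by rewrite potential_root //= addeNy //= ltNge leey.
by rewrite potential_nonroot // -EFinD -EFinB abse_EFin lte_fin.
Qed.

(** The logarithmic derivatives at b are bounded, hence have a limit L along F.
    The Taylor bound [log_mean_taylor], uniform in k, passes to the limit p and
    identifies L as its gradient. *)
Lemma logder_limit (F : set_system nat) (FU : UltraFilter F) q U E (p : C R -> R)
    (d : nat -> R) (N2 : set nat) N :
  within N2 \oo `<=` F -> (forall k, (0 < (size (q k)).-1)%N) ->
  open U -> no_accumulation_in U E -> clusters F q U N ->
  loc_unif_cvg_on (within N2 \oo) (U `\` E)
    (fun k z => (d k)%:E + potential (root_distribution (q k)) z)%E p ->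
  forall b, U b -> ~ E b -> N b = 0%N ->
     avg q predT (fun w => (b - w)^-1) k @[k --> F] --> complex_gradient p b.
Proof.
move=> sF dq oU hE hN hloc b Ub nEb Nb.
have [V /nbhs_cmodP [r1 r10 h1] hu] := hloc b (conj Ub nEb).
have FF : Filter F by exact: _.
have hconv := potential_cvg FF sF dq hu.
have [r2 r20 h2] := no_accumulationP hE Ub.
have [r3 r30 h3] := open_disc oU Ub.
have [r r0 hr] := hN _ Ub.
have hfar : \forall k \near F, forall w, w \in poly_roots (q k) -> far b r w.
  by apply: filterS (hr _ r0 (lexx _)) => k; rewrite Nb; exact: root_count0_far.
have bnd w : far b r w -> cmod (b - w)^-1 <= r^-1.
  by move=> hw; apply: cmod_inv_le => //; rewrite cmodC.
have hL := limavg_cvg FU (f := q) bnd.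
set L := limavg F q (far b r) _ in hL.
have hL' : avg q predT (fun w => (b - w)^-1) k @[k --> F] --> L.
  apply: (cvg_near_eq FU _ hL).
  by apply: filterS hfar => k h; apply/esym/avg_all.
suff -> : complex_gradient p b = L by exact: hL'.
(* Within d0 of b the convergence is uniform, no exceptional point occurs and
   the Taylor bound holds. *)
pose d0 := Num.min (Num.min r1 (r / 2)) (Num.min r2 r3).
have d00 : 0 < d0 by rewrite !lt_min r10 r20 r30 divr_gt0.
have rr0 : 0 <= 13 / r ^+ 2 by rewrite divr_ge0 // exprn_ge0 // ltW.
apply: (quad_gradient rr0 d00) => t.
rewrite !lt_min => /andP[/andP[t1 t2] /andP[t3 t4]].
have At z : cmod (z - b) <= cmod t -> ((U `\` E) `&` V) z.
  move=> hz; split; last by apply: h1; lra.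
  split; first by apply: h3; lra.
  have [->//|zb] := eqVneq z b; apply: h2 => //; lra.
apply/ler_addgt0Pr => e e0.
have e3 : 0 < e / 4 by lra.
have et : 0 < e / 4 / (cmod t + 1).
  by rewrite divr_gt0 // ltr_wpDl ?cmod_ge0.
have /cvg_cmodP /(_ _ et) hl := hL'.
have [k [[k1 k2] k3]] := filter_ex (filterI (filterI (hconv _ e3) hfar) hl).
have c1 := k1 (b + t) (At _ _); have c2 := k1 b (At _ _).
have {}c1 : `|d k + log_mean (q k) (b + t) - p (b + t)| < e / 4.
  by apply: c1; rewrite addrAC subrr add0r.
have {}c2 : `|d k + log_mean (q k) b - p b| < e / 4.
  by apply: c2; rewrite subrr cmod0 cmod_ge0.
have c3 := log_mean_taylor r0 k2 (ltW t2).
rewrite -avg_invsum in c3.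
have c4 : `|complex.Re (t * avg (fun=> q k) predT (fun w => (b - w)^-1) k) -
   complex.Re (t * L)| <= e / 4.
  have -> : complex.Re (t * avg (fun=> q k) predT (fun w => (b - w)^-1) k) -
    complex.Re (t * L) =
    complex.Re (t * (avg q predT (fun w => (b - w)^-1) k - L)).
    by rewrite mulrBr; case: (t * _) => ? ?; case: (t * _).
  apply: le_trans (Re_le_cmod _) _; rewrite cmodM.
  move: k3; rewrite ltr_pdivlMr ?ltr_wpDl ?cmod_ge0 // => k3.
  have := cmod_ge0 t.
  have := cmod_ge0 (avg q predT (fun w => (b - w)^-1) k - L); nra.
move: c1 c2 c3 c4; rewrite !ltr_norml !ler_norml.
by move=> /andP[? ?] /andP[? ?] /andP[? ?] /andP[? ?]; apply/andP; split; lra.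
Qed.

Lemma infinite_within_proper (N2 : set nat) : infinite_set N2 ->
  ProperFilter (within N2 \oo).
Proof.
move=> inf; apply: Build_ProperFilter_ex.
move=> A [n _ hn]; apply: contrapT => hA; apply: inf.
apply: (sub_finite_set _ (finite_II n)) => k Nk /=.
rewrite ltnNge; apply/negP => nk; apply: hA; exists k; exact: hn.
Qed.

Lemma not_near_infinite (P : nat -> Prop) :
  ~ (\forall k \near \oo, P k) -> infinite_set [set k | ~ P k].
Proof.
move=> hP /finite_seqP[s hs]; apply: hP.
exists (\max_(i <- s) i).+1 => // k /= hk; apply: contrapT => nP.
have ks : k \in s by have : [set k | ~ P k] k by []; rewrite hs.
by move: hk; rewrite ltnNge => /negP; apply; exact: (@leq_bigmax_seq _ s predT id).
Qed.

End Main.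

Theorem theorem2 (R : realType) (q : nat -> {poly C R}) (U : set (C R))
    (p : C R -> R)
    (q_monic : forall k, q k \is monic)
    (deg_gt0 : forall k, (0 < (size (q k)).-1)%N)
    (deg_infty : (size (q k)).-1 @[k --> \oo] --> \oo)
    (U_open : open U)
    (p_harmonic : harmonic_on U p)
    (p_nonconst : nowhere_locally_constant U p)
    (U_sparse : root_sparse q U)
    (p_limit : forall N1 : set nat, infinite_set N1 ->
      exists (N2 : set nat) (E : set (C R)) (d : nat -> R),
        [/\ infinite_set N2, N2 `<=` N1, E `<=` U, no_accumulation_in U E &
            loc_unif_cvg_on (within N2 \oo) (U `\` E)
              (fun k z => (d k)%:E + potential (root_distribution (q k)) z)%E
              p]) :
  forall m : nat,
    divisor_cvg U
      (fun k z => zero_divisor (fun w => (q k)^`(m).[w]) z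
                  - zero_divisor (fun w => (q k).[w]) z)
      (fun z => zero_divisor (complex_gradient p) z *+ m).
Proof.
move=> m phi hphi; apply/cvg_cmodP => e e0.
(* The indices at which the pairing is off by e are infinitely many. *)
apply: contrapT => /not_near_infinite /p_limit [N2 [E [d [inf sN EU hE hloc]]]].
have [F [FU sF]] := ultraFilterLemma (infinite_within_proper inf).
have ooF : \oo `<=` F.
  by move=> A hA; apply: sF; apply: filterS hA => k Ak _.
have FN2 : F N2 by apply: sF; exact: withinT.
set G := complex_gradient p.
have [hp _ _ _] := p_harmonic.
have cG z : U z -> {for z, continuous G} by exact: gradient_continuous.
have [N hN] := clusters_exist FU ooF U_open U_sparse.
have dq : deg_oo F q.
  by move=> n; apply: ooF; move/cvgnyPgt: deg_infty; exact.
have hreg0 := regularity FU dq U_open hN hE cG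
  (logder_limit FU sF deg_gt0 U_open hE hN hloc).
pose s a := zero_order G a.
have hfac a : U a -> zero_factor G a (s a).
  move=> Ua; have [n hn] := zero_factor_exists FU (hreg0 _ Ua)
    (gradient_nonzero U_open hp p_nonconst Ua).
  by rewrite /s (zero_orderE (zero_factor_order hn)).
(* Each derivation adds the order of the gradient to the number of roots that
   tend to a point. *)
have step n : [/\ deg_oo F (fun k => (q k)^`(n)),
    clusters F (fun k => (q k)^`(n)) U (fun a => N a + n * s a)%N &
    forall a, U a -> regular_at F (fun k => (q k)^`(n)) U G (fun a => N a + n * s a)%N a].
  elim: n => [|n [h1 h2 h3]].
    have -> : (fun a => N a + 0 * s a)%N = N by apply: funext => a; rewrite addn0.
    by have -> : (fun k => (q k)^`(0)) = q by [].
  have -> : (fun k => (q k)^`(n.+1)) = (fun k => ((q k)^`(n))^`()).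
    by apply: funext => k; rewrite derivnS.
  have hc : clusters F (fun k => ((q k)^`(n))^`()) U (fun a => N a + n.+1 * s a)%N.
    move=> a Ua; have [r r0 hr] := deriv_clusters FU h1 h3 Ua h2 (hfac _ Ua).
    by exists r => //; rewrite mulSn addnCA addnC.
  split => //; first exact: deg_oo_deriv.
  apply: (@regularity _ F FU (fun k => ((q k)^`(n))^`()) U set0) => //.
    exact: deg_oo_deriv.
    by move=> z _ /(_ setT filterT) [y []].
  move=> b Ub _ /eqP; rewrite addn_eq0 muln_eq0 /= => /andP[Nb sb].
  apply: (deriv_avg FU h1 (h3 _ Ub)); first by rewrite (eqP Nb) (eqP sb) muln0.
  have [g [h [K K0 [r r0 hg]]]] := hfac _ Ub.
  have [|-> gb _ _] := hg b; first by rewrite subrr cmod0.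
  by rewrite (eqP sb) expr0 mul1r.
have [dm hm _] := step m.
have [cphi cK KU] := hphi; set K := closure _ in cK KU.
(* The points to which roots of the m-th derivative tend include those of the
   original polynomials, so one finite set serves both sums. *)
pose P := [set b | U b /\ (N b + m * s b)%N != 0%N].
have finP : finite_set (K `&` P).
  apply: compact_isolated_finite => // a Ka.
  have [r r0 hr] := hm _ (KU _ Ka); exists r => // z Kz za zr [Uz].
  by have [-> _] := clusters_isolated FU hm hr Uz za zr.
have [S uS SE] : exists2 S : seq (C R), uniq S & K `&` P = [set` S].
  have /finite_seqP [S0 hS0] := finP; exists (undup S0); first exact: undup_uniq.
  by rewrite hS0; apply/seteqP; split=> x /=; rewrite mem_undup.
have SK b : b \in S -> K b.
  by move=> bS; have : [set` S] b by []; rewrite -SE => -[].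
have hS b : K b -> (N b + m * s b)%N != 0%N -> b \in S.
  move=> Kb nb; have : (K `&` P) b by split=> //; split=> //; exact: KU.
  by rewrite SE.
have c1 := clusters_sum FU hm hphi uS SK hS.
have c0 : (\sum_(w <- poly_roots (q k)) phi w) @[k --> F] --> \sum_(b <- S) phi b *+ N b.
  apply: (clusters_sum FU hN hphi uS SK) => b Kb nb; apply: hS => //.
  by rewrite addn_eq0 negb_and nb.
have phi0 z : ~ U z -> phi z = 0.
  move=> nU; apply/eqP/negP => /negP hz; apply: nU; apply: KU.
  exact: subset_closure.
have lim : divisor_pairing U (fun z => zero_divisor G z *+ m) phi =
    \sum_(b <- S) phi b *+ (N b + m * s b) - \sum_(b <- S) phi b *+ N b.
  have sE b : zero_divisor G b *+ m = (m * s b)%:Z.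
    by rewrite /zero_divisor -mulr_natr natz -PoszM mulnC.
  rewrite /divisor_pairing (fsbigE S) //; last 2 first.
  - by move=> b /= /SK /KU.
  - move=> b Ub /negP bS.
    have [Kb|nK] := pselect (K b); last first.
      have -> : phi b = 0 by apply/eqP/negP => /negP h; apply/nK/subset_closure.
      by rewrite mul0rz.
    have : ~~ ((N b + m * s b)%N != 0%N) by apply/negP => h; apply: bS; exact: hS.
    rewrite negbK addn_eq0 => /andP[_ /eqP h].
    by rewrite sE h mulr0z.
  rewrite -sumrB big_seq_cond [RHS]big_seq; apply: eq_big => b; last first.
    move=> _; rewrite mulrnDr addrAC subrr add0r.
    by rewrite sE.
  by case: (boolP (b \in S)) => //= bS; rewrite mem_set //; exact/KU/SK.
have : \forall k \near F, cmod (divisor_pairing U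
   (fun z => zero_divisor (fun w => (q k)^`(m).[w]) z
                  - zero_divisor (fun w => (q k).[w]) z) phi
   - divisor_pairing U (fun z => zero_divisor G z *+ m) phi) < e.
  have /cvg_cmodP /(_ _ e0) := cvg_subp FU c1 c0.
  apply: filterS2 (dm 0%N) => k dk; rewrite pairing_poly ?lim //.
    by apply: contraTneq dk => ->; rewrite size_poly0.
  by apply: contraTneq (deg_gt0 k) => ->; rewrite size_poly0.
by move=> /(filterI FN2) /filter_ex [k [/sN]].
Qed.
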